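(* Let $(p_n)$ and $(q_n)$ be arbitrary sequences of positive integers with $\max(p_n,q_n)\to+\infty$. Let $(\mathbf{X}_{ni}',\mathbf{Y}_{ni}')'$, $i=1,\ldots,n$, $n=1,2,\ldots$, be a triangular array such that, for each $n$, the random vectors $(\mathbf{X}_{ni}',\mathbf{Y}_{ni}')'$, $i=1,\ldots,n$, are i.i.d., with $\mathbf{X}_{ni}\in\mathbb{R}^{p_n}$ and $\mathbf{Y}_{ni}\in\mathbb{R}^{q_n}$ independent and having spherical directions in $\mathbb{R}^{p_n}$ and $\mathbb{R}^{q_n}$ respectively. Let $\mathbf{U}_{ni}=\mathbf{X}_{ni}/\|\mathbf{X}_{ni}\|$, $\mathbf{V}_{ni}=\mathbf{Y}_{ni}/\|\mathbf{Y}_{ni}\|$ and $I_n=\frac{p_nq_n}{n}\sum_{i,j=1}^n(\mathbf{U}_{ni}'\mathbf{U}_{nj})(\mathbf{V}_{ni}'\mathbf{V}_{nj})$. Then $$I_n^{\rm St}=\frac{I_n-p_nq_n}{\sqrt{2p_nq_n}}=\frac{\sqrt{2p_nq_n}}{n}\sum_{1\le i<j\le n}(\mathbf{U}_{ni}'\mathbf{U}_{nj})(\mathbf{V}_{ni}'\mathbf{V}_{nj})$$ converges in distribution to the standard normal distribution as $n\to\infty$.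
   Context: A distribution on $\mathbb{R}^p$ has spherical directions if it puts no mass at the origin and, for $\mathbf{X}$ with this distribution, $\mathbf{X}/\|\mathbf{X}\|$ is uniformly distributed on the unit sphere $\mathcal{S}^{p-1}$. *)

(* Defs.v *)
From HB Require Import structures.
From mathcomp Require Import all_boot all_order all_algebra.
From mathcomp Require Import all_classical all_reals all_analysis.
From mathcomp Require Import normal_distribution.
Set Implicit Arguments. Unset Strict Implicit. Unset Printing Implicit Defensive.
Import Order.TTheory GRing.Theory Num.Theory.
Local Open Scope classical_set_scope.
Local Open Scope ring_scope.

Section defs.
Context {R : realType}.

(* Borel (= product) sigma-algebra on R^k, realised as row vectors 'rV[R]_k:
   generated by the coordinate preimages of Borel sets of R. *)
Definition rv_borel (k : nat) : set (set 'rV[R]_k) :=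
  <<s [set A | exists (j : 'I_k) (B : set R), measurable B /\
                 A = (fun v : 'rV[R]_k => v ord0 j) @^-1` B] >>.

Definition dotv (k : nat) (u v : 'rV[R]_k) : R := \sum_(j < k) u ord0 j * v ord0 j.
Definition enorm (k : nat) (v : 'rV[R]_k) : R := Num.sqrt (dotv v v).
Definition direction (k : nat) (v : 'rV[R]_k) : 'rV[R]_k := (enorm v)^-1 *: v.

Definition orthogonal_mx (k : nat) (O : 'M[R]_k) : Prop := O *m O^T = 1%:M.

Context {d : measure_display} {Omega : measurableType d}.
Variable P : probability Omega R.

Definition random_vector (k : nat) (Z : Omega -> 'rV[R]_k) : Prop :=
  forall j : 'I_k, measurable_fun setT (fun w => Z w ord0 j).

Definition lawv (k : nat) (Z : Omega -> 'rV[R]_k) (A : set 'rV[R]_k) : \bar R :=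
  P (Z @^-1` A).

(* uniform distribution on the unit sphere S^{k-1}: the (unique) probability
   on the sphere invariant under all orthogonal transformations *)
Definition uniform_on_sphere (k : nat) (U : Omega -> 'rV[R]_k) : Prop :=
  P [set w | enorm (U w) = 1] = 1%E /\
  forall O : 'M[R]_k, orthogonal_mx O ->
    forall A, rv_borel A -> lawv U A = lawv (fun w => U w *m O) A.

Definition spherical_directions (k : nat) (Z : Omega -> 'rV[R]_k) : Prop :=
  P [set w | Z w = 0] = 0%E /\ uniform_on_sphere (fun w => direction (Z w)).

Definition indep2 (k l : nat) (Z : Omega -> 'rV[R]_k) (T : Omega -> 'rV[R]_l) : Prop :=
  forall A B, rv_borel A -> rv_borel B ->
    P (Z @^-1` A `&` T @^-1` B) = (P (Z @^-1` A) * P (T @^-1` B))%E.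

Definition mutually_indep (I : finType) (k : nat) (W : I -> Omega -> 'rV[R]_k) : Prop :=
  forall (A : I -> set 'rV[R]_k), (forall i, rv_borel (A i)) ->
  forall J : {set I},
    P [set w | forall i, i \in J -> A i (W i w)] = (\prod_(i in J) P (W i @^-1` A i))%E.

Definition ident_distr (I : Type) (k : nat) (W : I -> Omega -> 'rV[R]_k) : Prop :=
  forall i j A, rv_borel A -> lawv (W i) A = lawv (W j) A.

Definition iid (I : finType) (k : nat) (W : I -> Omega -> 'rV[R]_k) : Prop :=
  (forall i, random_vector (W i)) /\ mutually_indep W /\ ident_distr W.

End defs.

Definition I_stat {R : realType} {Omega : Type} (n p q : nat)
  (X : 'I_n -> Omega -> 'rV[R]_p) (Y : 'I_n -> Omega -> 'rV[R]_q) (w : Omega) : R :=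
  (p * q)%:R / n%:R *
  \sum_(i < n) \sum_(j < n)
     dotv (direction (X i w)) (direction (X j w)) *
     dotv (direction (Y i w)) (direction (Y j w)).

Definition I_St {R : realType} {Omega : Type} (n p q : nat)
  (X : 'I_n -> Omega -> 'rV[R]_p) (Y : 'I_n -> Omega -> 'rV[R]_q) (w : Omega) : R :=
  (I_stat X Y w - (p * q)%:R) / Num.sqrt (2 * (p * q)%:R).

Definition I_St_alt {R : realType} {Omega : Type} (n p q : nat)
  (X : 'I_n -> Omega -> 'rV[R]_p) (Y : 'I_n -> Omega -> 'rV[R]_q) (w : Omega) : R :=
  Num.sqrt (2 * (p * q)%:R) / n%:R *
  \sum_(i < n) \sum_(j < n | (i < j)%N)
     dotv (direction (X i w)) (direction (X j w)) *
     dotv (direction (Y i w)) (direction (Y j w)).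

(* Main.v *)
(** Let [U i], [V i] be the directions, a_ij = sqrt(2pq)/n <U_i,U_j><V_i,V_j>,
T_i = sum_(j <> i) a_ij, so that the statistic is S = 1/2 sum_i T_i.  The proof is
Stein's method.  Rotation invariance makes the kernel isotropic: given the other
vectors, a_ij has mean zero, E a_ij a_ik = 2/n^2 <U_j,U_k><V_j,V_k>, products of
three entries of a row vanish and fourth moments are O(n^-4).  As S - T_i is
independent of the i-th pair, E S f(S) = 1/2 sum_i E T_i (f(S) - f(S - T_i)), which
is E f'(S) V up to O(n^-1/2), where V = 1/2 sum_i T_i^2 satisfies
E (V - 1)^2 <= 2/(pq) + 23/n; hence E (S f(S) - f'(S)) tends to 0.

For u, v Lipschitz with compact support, k = N(v) u - N(u) v has Gaussian mean 0, so
the solution f of f'(x) - x f(x) = k(x) has compact support too and no tail estimate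
is needed; thus N(v) E u(S) - N(u) E v(S) tends to 0.  Letting v increase to 1, the
bound E S^2 <= 1 gives E u(S) -> N(u), and then convergence of the distribution
functions. *)

Require Import Defs.
From HB Require Import structures.
From mathcomp Require Import all_boot all_order all_algebra.
From mathcomp Require Import all_classical all_reals all_analysis.
From mathcomp Require Import normal_distribution measurable_realfun.
From mathcomp Require Import ring lra.
Set Implicit Arguments. Unset Strict Implicit. Unset Printing Implicit Defensive.
Import Order.TTheory GRing.Theory Num.Theory.
Import numFieldNormedType.Exports.
Local Open Scope classical_set_scope.
Local Open Scope ring_scope.

(** * Bounded random variables and independence *)

(** The statistic is a degenerate double sum: no summand is independent of the rest, so no classical
    central limit theorem for sums applies. The row sum T_i plays the part that a single summand
    plays in Stein's method, because deleting it removes every trace of the i-th pair.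

    The error 2/(pq) comes from triangles. Rows i and k are correlated through each third index l by
    the product a_li a_lk; integrating out the pair l contracts this product to a multiple of the
    kernel at (i, k), whose mean square is 1/(pq). No other error term involves the dimensions: the
    scaling cancels them in the variances and in the fourth moment bounds. As p and q are at least
    1, growth of the larger one is enough.

    Two devices keep the measure theory light. The kernel is a finite sum of products of
    coordinates, so integrating one pair with the others frozen is linearity plus independence.
    Moments of row sums are found by adding one index at a time to a list, the new index being
    independent of all that was summed before. *)

Section bounded_measurable.
Context {R : realType} {d : measure_display} {T : measurableType d}.
Implicit Types f g : T -> R.

(** Coordinates of directions are bounded by 1, so a class closed under ring operations disposes of
    every integrability condition. The bound is pointwise: the class needs no measure and makes
    sense for any sigma-algebra on [T]. *)
Definition bdm f := measurable_fun setT f /\ exists M : R, forall t, `|f t| <= M.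

Lemma eq_bdm f g : f =1 g -> bdm f -> bdm g.
Proof. by move=> /funext ->. Qed.

Lemma bdm_cst c : bdm (fun=> c).
Proof. by split; [exact: measurable_cst|exists `|c|]. Qed.

Lemma bdmD f g : bdm f -> bdm g -> bdm (fun t => f t + g t).
Proof.
move=> [mf [M fM]] [mg [N gN]]; split; first exact: measurable_funD.
by exists (M + N) => t; rewrite (le_trans (ler_normD _ _))// lerD.
Qed.

Lemma bdmN f : bdm f -> bdm (fun t => - f t).
Proof.
move=> [mf [M fM]]; split; first exact: measurable_funN.
by exists M => t; rewrite normrN.
Qed.

Lemma bdmM f g : bdm f -> bdm g -> bdm (fun t => f t * g t).
Proof.
move=> [mf [M fM]] [mg [N gN]]; split; first exact: measurable_funM.
by exists (M * N) => t; rewrite normrM ler_pM.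
Qed.

Lemma bdmX f n : bdm f -> bdm (fun t => f t ^+ n).
Proof.
move=> [mf [M fM]]; split; first exact: measurable_funX.
by exists (M ^+ n) => t; rewrite normrX lerXn2r// nnegrE// (le_trans _ (fM t)).
Qed.

Lemma bdm_norm f : bdm f -> bdm (fun t => `|f t|).
Proof.
move=> [mf [M fM]]; split; first exact: measurableT_comp.
by exists M => t; rewrite normr_id.
Qed.

Lemma bdm_sum (I : Type) (r : seq I) (Q : pred I) (F : I -> T -> R) :
  (forall i, Q i -> bdm (F i)) -> bdm (fun t => \sum_(i <- r | Q i) F i t).
Proof.
move=> bF; elim: r => [|i r IH].
  by apply: eq_bdm (bdm_cst 0) => t; rewrite big_nil.
have [Qi|Qi] := boolP (Q i).
  by apply: eq_bdm (bdmD (bF i Qi) IH) => t; rewrite big_cons Qi.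
by apply: eq_bdm IH => t; rewrite big_cons (negbTE Qi).
Qed.

Lemma bdm_comp (phi : R -> R) f : measurable_fun setT phi ->
  (exists M : R, forall x, `|phi x| <= M) -> measurable_fun setT f ->
  bdm (fun t => phi (f t)).
Proof.
move=> mphi [M phiM] mf; split; first exact: measurableT_comp.
by exists M.
Qed.

End bounded_measurable.

(** Boundedness together with measurability for the sigma-algebra generated by [H] instead of the
    ambient one. Being an instance of [bdm], it inherits all the closure lemmas. *)
Definition sub_bdm {R : realType} {T : pointedType} (H : set (set T)) (G : T -> R) :=
  @bdm R _ (g_sigma_algebraType H) G.

Ltac bdm := repeat first [assumption | apply: bdm_cst | apply: bdmX
  | apply: bdm_norm | apply: bdmD | apply: bdmN | apply: bdmM].

Section expectation.
Context {R : realType} {d : measure_display} {T : measurableType d}.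
Variable P : probability T R.
Implicit Types f g : T -> R.

Definition Ex f : R := \int[P]_w f w.

Lemma bdm_integrable f : bdm f -> P.-integrable setT (EFin \o f).
Proof.
move=> [mf [M fM]]; apply: measurable_bounded_integrable => //.
  by rewrite (le_lt_trans (probability_le1 P measurableT))// ltry.
by exists M; split; [exact: num_real|move=> x Mx t _ /=; exact: le_trans (fM t) (ltW Mx)].
Qed.

Lemma eq_Ex f g : f =1 g -> Ex f = Ex g.
Proof. by move=> /funext ->. Qed.

Lemma ExD f g : bdm f -> bdm g -> Ex (fun t => f t + g t) = Ex f + Ex g.
Proof. by move=> bf bg; rewrite /Ex RintegralD//; exact: bdm_integrable. Qed.

Lemma ExZ c f : bdm f -> Ex (fun t => c * f t) = c * Ex f.
Proof. by move=> bf; rewrite /Ex RintegralZl//; exact: bdm_integrable. Qed.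

Lemma ExN f : bdm f -> Ex (fun t => - f t) = - Ex f.
Proof.
by move=> bf; rewrite -mulN1r -ExZ//; apply: eq_Ex => t; rewrite mulN1r.
Qed.

Lemma ExB f g : bdm f -> bdm g -> Ex (fun t => f t - g t) = Ex f - Ex g.
Proof. by move=> bf bg; rewrite ExD ?ExN//; exact: bdmN. Qed.

Lemma Ex_cst c : Ex (fun=> c) = c.
Proof. transitivity (c * fine (P setT)); first exact: Rintegral_cst.
by rewrite probability_setT/= mulr1. Qed.

Lemma Ex_sum (I : Type) (r : seq I) (Q : pred I) (F : I -> T -> R) :
  (forall i, Q i -> bdm (F i)) ->
  Ex (fun t => \sum_(i <- r | Q i) F i t) = \sum_(i <- r | Q i) Ex (F i).
Proof.
move=> bF; elim: r => [|i r IH].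
  by rewrite big_nil -[RHS]Ex_cst; apply: eq_Ex => t; rewrite big_nil.
rewrite big_cons -IH; case: ifP => Qi; last first.
  by apply: eq_Ex => t; rewrite big_cons Qi.
rewrite -ExD; [|exact: bF|exact: bdm_sum].
by apply: eq_Ex => t; rewrite big_cons Qi.
Qed.

Lemma Ex_le f g : bdm f -> bdm g -> (forall t, f t <= g t) -> Ex f <= Ex g.
Proof. by move=> bf bg fg; apply: le_Rintegral => //; exact: bdm_integrable. Qed.

Lemma Ex_ge0 f : (forall t, 0 <= f t) -> 0 <= Ex f.
Proof. by move=> f0; exact: Rintegral_ge0. Qed.

Lemma Ex_norm f : bdm f -> `|Ex f| <= Ex (fun t => `|f t|).
Proof. by move=> bf; apply: le_normr_Rintegral => //; exact: bdm_integrable. Qed.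

Lemma Ex_ae f g : bdm f -> bdm g -> (\forall t \ae P, f t = g t) -> Ex f = Ex g.
Proof.
move=> [mf _] [mg _] fg; rewrite /Ex /Rintegral; congr fine.
apply: ae_eq_integral => //; [exact/measurable_EFinP|exact/measurable_EFinP|].
by apply: filterS fg => t fgt _ /=; rewrite fgt.
Qed.

Lemma Ex_law (f g : T -> R) : measurable_fun setT f -> measurable_fun setT g ->
  (forall B, measurable B -> P (f @^-1` B) = P (g @^-1` B)) -> Ex f = Ex g.
Proof.
move=> mf mg fg.
(* For nonnegative [phi] the change of variables needs no integrability; it is applied below to the
   positive and the negative part. *)
have h (phi : R -> R) : measurable_fun setT phi -> (forall x, 0 <= phi x) ->
    (\int[P]_t (phi (f t))%:E = \int[P]_t (phi (g t))%:E)%E.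
  move=> mphi phi0.
  have mE : measurable_fun setT (EFin \o phi) by exact/measurable_EFinP.
  transitivity (\int[pushforward P f]_x (phi x)%:E)%E.
    by rewrite ge0_integral_pushforward//=; move=> x _; rewrite lee_fin.
  transitivity (\int[pushforward P g]_x (phi x)%:E)%E; last first.
    by rewrite ge0_integral_pushforward//=; move=> x _; rewrite lee_fin.
  by apply: eq_measure_integral => A mA _; exact: fg.
rewrite /Ex /Rintegral; congr fine; rewrite integralE [RHS]integralE.
congr (_ - _)%E.
  transitivity (\int[P]_t ((fun x => Order.max x 0) (f t))%:E)%E.
    by apply: eq_integral => t _; rewrite funeposE EFin_max.
  rewrite (h (fun x => Order.max x 0)).
  - by apply: eq_integral => t _; rewrite funeposE EFin_max.
  - exact: measurable_funrpos.
  - by move=> x; rewrite le_max lexx orbT.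
transitivity (\int[P]_t ((fun x => Order.max (- x) 0) (f t))%:E)%E.
  by apply: eq_integral => t _; rewrite funenegE EFin_max.
rewrite (h (fun x => Order.max (- x) 0)).
- by apply: eq_integral => t _; rewrite funenegE EFin_max.
- exact: measurable_funrneg.
- by move=> x; rewrite le_max lexx orbT.
Qed.

End expectation.

Section independence.
Context {R : realType} {d : measure_display} {T : measurableType d}.
Variable P : probability T R.

Lemma Ex_distribution (d' : measure_display) (T' : measurableType d')
    (H : {mfun T >-> T'}) (phi : T' -> R) : bdm phi ->
  Ex (distribution P H) phi = Ex P (fun w => phi (H w)).
Proof.
move=> [mphi [M phiM]]; rewrite /Ex /Rintegral integral_distribution//.
  exact/measurable_EFinP.
apply: (@bdm_integrable _ _ _ P (phi \o H)); split; last by exists M => t /=.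
exact: measurableT_comp.
Qed.

(** The identity of R is unbounded, hence not [bdm]. Truncated at a bound of [f] it becomes so,
    without changing the values taken along [f]; this lets the joint law be integrated on R * R. *)
Definition clamp (M x : R) := Order.max (- M) (Order.min x M).

Lemma clamp_le M x : `|clamp M x| <= `|M|.
Proof.
rewrite /clamp; case: (leP x M) => xM; case: (leP (- M)) => Mx; rewrite ?normrN//.
by rewrite (le_trans _ (ler_norm M))// ler_norml Mx xM.
Qed.

Lemma clamp_bdm M : bdm (clamp M).
Proof.
split; first by apply: measurable_maxr => //; exact: measurable_minr.
by exists `|M| => x; exact: clamp_le.
Qed.

Lemma clamp_id M x : `|x| <= M -> clamp M x = x.
Proof.
rewrite ler_norml => /andP[Mx xM]; rewrite /clamp.
by rewrite (min_idPl xM) (max_idPr Mx).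
Qed.

Lemma Ex_indep (f g : T -> R) : bdm f -> bdm g ->
  (forall A B, measurable A -> measurable B ->
    P (f @^-1` A `&` g @^-1` B) = (P (f @^-1` A) * P (g @^-1` B))%E) ->
  Ex P (fun w => f w * g w) = Ex P f * Ex P g.
Proof.
move=> [mf [M fM]] [mg [N gN]] ind.
pose X : {mfun T >-> R} := HB.pack f (isMeasurableFun.Build _ _ _ _ f mf).
pose Y : {mfun T >-> R} := HB.pack g (isMeasurableFun.Build _ _ _ _ g mg).
have mh : measurable_fun setT (fun w => (f w, g w)) by exact: measurable_fun_pair.
pose H : {mfun T >-> (R * R)%type} :=
  HB.pack (fun w => (f w, g w)) (isMeasurableFun.Build _ _ _ _ _ mh).
have [mcM [M' cM']] := clamp_bdm M; have [mcN [N' cN']] := clamp_bdm N.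
have bM : bdm (clamp M) by exact: clamp_bdm.
have bN : bdm (clamp N) by exact: clamp_bdm.
pose k (z : R * R) := clamp M z.1 * clamp N z.2.
have bk : bdm k.
  split; last first.
    by exists (M' * N') => z; rewrite normrM ler_pM.
  by apply: measurable_funM; exact: measurableT_comp.
have XE : Ex (distribution P X) (clamp M) = Ex P f.
  rewrite Ex_distribution//; apply: eq_Ex => w; exact: clamp_id.
have YE : Ex (distribution P Y) (clamp N) = Ex P g.
  rewrite Ex_distribution//; apply: eq_Ex => w; exact: clamp_id.
transitivity (Ex (distribution P H) k).
  rewrite Ex_distribution//; apply: eq_Ex => w.
  by rewrite /k/= !clamp_id.
have ik : (distribution P X \x distribution P Y)%E.-integrable setT (EFin \o k).
  apply: measurable_bounded_integrable => //.
  - have : ((distribution P X \x distribution P Y) (setT `*` setT) < +oo)%E.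
      rewrite product_measure1E//.
      apply: (@le_lt_trans _ _ (1 * 1)%E); last by rewrite mule1 ltry.
      by apply: lee_pmul => //; exact: probability_le1.
    by rewrite setXTT.
  - by case: bk.
  - case: bk => _ [K kK]; exists K; split; first exact: num_real.
    by move=> x Kx z _ /=; exact: le_trans (kK z) (ltW Kx).
rewrite -XE -YE {1}/Ex /Rintegral.
transitivity (fine (\int[(distribution P X \x distribution P Y)%E]_z (k z)%:E)%E).
  congr fine; apply: eq_measure_integral => A mA _.
  (* Independence says that the joint law agrees with the product of the marginal laws on
     rectangles, which determines it. *)
  apply/esym/(product_measure_unique (m' := distribution P H)) => //.
rewrite -[X in fine X](integral12_prod_meas1 ik) /fubini_F.
transitivity (fine (\int[distribution P X]_x
    (clamp M x * Ex (distribution P Y) (clamp N))%:E)%E).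
  congr fine; apply: eq_integral => x _.
  rewrite -[in RHS]ExZ// /Ex /Rintegral fineK//.
  apply: integrable_fin_num => //.
  by apply: (@bdm_integrable _ _ _ (distribution P Y)); bdm.
transitivity (Ex (distribution P X)
  (fun x => Ex (distribution P Y) (clamp N) * clamp M x)).
  by apply: eq_Ex => x; rewrite mulrC.
by rewrite ExZ// mulrC.
Qed.

(** Both sides are finite measures in [B], a restriction and a multiple of [P]. They agree on the
    pi-system [G], hence on the sigma-algebra that it generates. *)
Lemma sigma_indep (E : set T) (G : set (set T)) : measurable E ->
  G `<=` measurable -> setI_closed G -> G setT ->
  (forall B, G B -> P (E `&` B) = (P E * P B)%E) ->
  forall B, <<s G >> B -> P (E `&` B) = (P E * P B)%E.
Proof.
move=> mE Gm GI GT ind B GB.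
have PEf : P E = (fine (P E))%:E by rewrite fineK// fin_num_measure.
have PE0 : 0 <= fine (P E) by rewrite fine_ge0.
have cov : \bigcup_(k in [set: nat]) [set: T] = setT.
  by apply/seteqP; split => // w _; exists 0%N.
have := @g_sigma_algebra_measure_unique _ R T G Gm (fun=> setT) (fun=> GT)
  cov (mrestr P mE) (mscale (NngNum PE0) P) GI.
move=> U; rewrite PEf setIC; apply: U GB.
  move=> A GA; rewrite /mrestr /mscale/=; transitivity (P E * P A)%E.
    by rewrite -[LHS]/(P (A `&` E)) setIC ind.
  by rewrite [in LHS]PEf.
move=> _; rewrite -[X in (X < _)%E]/(P (setT `&` E)) setTI.
by rewrite (le_lt_trans (probability_le1 P mE))// ltry.
Qed.

End independence.

Section random_vectors.
Context {R : realType}.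

(** The generators inside [rv_borel], named apart so that [rvT] below is a measurable type whose
    measurable sets are those of [rv_borel]. *)
Definition rv_gen (k : nat) : set (set 'rV[R]_k) :=
  [set A | exists (j : 'I_k) (B : set R), measurable B /\
     A = (fun v : 'rV[R]_k => v ord0 j) @^-1` B].

Definition rvT k := g_sigma_algebraType (@rv_gen k).

Lemma measurable_coord k (j : 'I_k) :
  measurable_fun setT (fun v : rvT k => v ord0 j : R).
Proof.
move=> _ B mB; rewrite setTI; apply: sub_sigma_algebra; by exists j, B.
Qed.

Lemma measurable_rvP (d : measure_display) (T : measurableType d) k
    (Z : T -> rvT k) :
  (forall j, measurable_fun setT (fun w => Z w ord0 j)) -> measurable_fun setT Z.
Proof.
move=> mZ; apply: (@measurability _ _ _ (rvT k) _ _ (@rv_gen k)) => //.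
move=> _ [_ [j [B [mB ->]] <-]]; rewrite setTI.
by have := mZ j measurableT B mB; rewrite setTI.
Qed.

Context {d : measure_display} {T : measurableType d} (P : probability T R).
Context {I : finType} {k : nat} (W : I -> T -> 'rV[R]_k).
Hypothesis rW : forall i, random_vector (W i).
Hypothesis iW : mutually_indep P W.

(* A pi-system generating the sigma-algebra of the vectors [W j], j != i. *)
Definition others i : set (set T) :=
  [set B | exists A : I -> set 'rV[R]_k, (forall j, rv_borel (A j)) /\
     B = [set w | forall j, j != i -> A j (W j w)]].

(** A working substitute for independence of [W i]: unlike independence itself, measurability with
    respect to the other vectors is stable under sums and products. *)
Definition free i (G : T -> R) := sub_bdm (others i) G.

Lemma measurable_others i : others i `<=` measurable.
Proof.
move=> _ [A [mA ->]].
rewrite (_ : [set w | _] = \bigcap_(j in [set j | j != i]) (W j @^-1` A j)); last first.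
  by apply/seteqP; split => w /= h j ji; exact: h.
apply: fin_bigcap_measurable; first exact: finite_finset.
move=> j _; have := measurable_rvP (rW j) measurableT (mA j).
by rewrite setTI.
Qed.

Lemma free_bdm i G : free i G -> bdm G.
Proof.
move=> [mG bG]; split => // _ B mB.
have := mG measurableT B mB; apply: smallest_sub; last exact: measurable_others.
exact: sigma_algebra_measurable.
Qed.

Lemma bdm_rv i (phi : rvT k -> R) : bdm phi -> bdm (fun w => phi (W i w)).
Proof.
move=> [mphi [M phiM]]; split; last by exists M.
by apply: (measurableT_comp mphi); exact: (@measurable_rvP _ _ k (W i) (rW i)).
Qed.

Lemma free_rv i j (phi : rvT k -> R) : j != i -> bdm phi ->
  free i (fun w => phi (W j w)).
Proof.
move=> ji [mphi [M phiM]]; split; last by exists M.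
move=> _ B mB; rewrite setTI; apply: sub_sigma_algebra.
exists (fun l => if l == j then phi @^-1` B else setT); split.
  move=> l; case: ifP => _; last exact: (@measurableT _ (rvT k)).
  by have := mphi measurableT B mB; rewrite setTI.
apply/seteqP; split => w /= h; last by have := h j ji; rewrite eqxx.
by move=> l li; case: ifPn => // /eqP ->.
Qed.

Lemma Ex_free i (phi : rvT k -> R) G : bdm phi -> free i G ->
  Ex P (fun w => phi (W i w) * G w) = Ex P (fun w => phi (W i w)) * Ex P G.
Proof.
move=> bphi fG; apply: Ex_indep; [exact: bdm_rv|exact: free_bdm fG|].
case: bphi fG => [mphi _] [mG _] A B mA mB.
have rA : rv_borel (phi @^-1` A).
  by have := mphi measurableT A mA; rewrite setTI.
apply: (sigma_indep (G := others i)).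
- have := measurable_rvP (rW i) measurableT rA.
  by rewrite setTI.
- exact: measurable_others.
- move=> _ _ [A1 [mA1 ->]] [A2 [mA2 ->]].
  exists (fun j => A1 j `&` A2 j); split.
    by move=> j; apply: (@measurableI _ (rvT k)); [exact: mA1|exact: mA2].
  apply/seteqP; split => w /=; first by move=> [h1 h2] j ji; split; [exact: h1|exact: h2].
  by move=> h; split => j ji; case: (h j ji).
- exists (fun=> setT); split; first by move=> j; exact: (@measurableT _ (rvT k)).
  by apply/seteqP; split.
- move=> _ [C [mC ->]].
  (* Mutual independence is used for the family [D] over all indices and over all indices but [i];
     comparing the two products isolates the factor of [i]. *)
  pose D j := if j == i then phi @^-1` A else C j.
  have mD j : rv_borel (D j) by rewrite /D; case: ifP.
  have := iW mD (finset.finset predT); have := iW mD (finset.finset (predC1 i)).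
  rewrite [in X in _ -> X](bigD1 i)/=; last by rewrite inE.
  rewrite (eq_bigl (predC1 i)); last by move=> j; rewrite inE.
  rewrite [in X in _ -> X](eq_bigl (predC1 i)); last by move=> j; rewrite inE.
  move=> <-.
  rewrite (_ : P (W i @^-1` D i) = P ((fun w => phi (W i w)) @^-1` A)); last first.
    by rewrite /D eqxx.
  move=> E; rewrite (_ : _ `&` _ = [set w | forall j, j \in finset.finset predT -> D j (W j w)]).
    rewrite E; congr (_ * P _)%E; apply/seteqP; split => w /= h j.
      by move=> ji; move: (h j); rewrite /D inE/= ji (negbTE ji); apply.
    by rewrite /D inE/= => ji; move: (h j ji); rewrite (negbTE ji).
  apply/seteqP; split => w /=.
    by move=> [h1 h2] j _; rewrite /D; case: eqVneq => [->//|]; exact: h2.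
  move=> h; split; first by have := h i; rewrite inE /D eqxx; apply.
  by move=> j ji; have := h j; rewrite inE /D (negbTE ji); apply.
- by have := mG measurableT B mB; rewrite setTI.
Qed.

End random_vectors.

(** * Uniform directions *)

Section dot_product.
Context {R : realType} {k : nat}.
Implicit Types (u v x y : 'rV[R]_k) (O : 'M[R]_k).

Lemma dotvE u v : dotv u v = (u *m v^T) ord0 ord0.
Proof. by rewrite mxE; apply: eq_bigr => j _; rewrite mxE. Qed.

Lemma dotvC u v : dotv u v = dotv v u.
Proof. by apply: eq_bigr => j _; rewrite mulrC. Qed.

Lemma dotvDr u x y : dotv u (x + y) = dotv u x + dotv u y.
Proof. by rewrite -big_split; apply: eq_bigr => j _; rewrite mxE mulrDr. Qed.

Lemma dotvZr u (c : R) x : dotv u (c *: x) = c * dotv u x.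
Proof. by rewrite mulr_sumr; apply: eq_bigr => j _; rewrite mxE mulrCA. Qed.

Lemma dotvBr u x y : dotv u (x - y) = dotv u x - dotv u y.
Proof. by rewrite -scaleN1r dotvDr dotvZr mulN1r. Qed.

Lemma dotvDl u x y : dotv (x + y) u = dotv x u + dotv y u.
Proof. by rewrite dotvC dotvDr !(dotvC u). Qed.

Lemma dotvZl u (c : R) x : dotv (c *: x) u = c * dotv x u.
Proof. by rewrite dotvC dotvZr dotvC. Qed.

Lemma dotvBl u x y : dotv (x - y) u = dotv x u - dotv y u.
Proof. by rewrite dotvC dotvBr !(dotvC u). Qed.

Lemma dotv_ge0 u : 0 <= dotv u u.
Proof. by apply: sumr_ge0 => j _; rewrite -expr2 sqr_ge0. Qed.

Lemma dotv_eq0 u : (dotv u u == 0) = (u == 0).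
Proof.
apply/idP/idP => [|/eqP ->]; last first.
  by rewrite /dotv big1// => j _; rewrite mxE mul0r.
rewrite /dotv psumr_eq0; last by move=> j _; rewrite -expr2 sqr_ge0.
move=> /allP h; apply/eqP/rowP => j; rewrite [RHS]mxE; apply/eqP.
by have := h j (mem_index_enum _); rewrite /= mulf_eq0 orbb.
Qed.

Lemma dotv_delta u (j : 'I_k) : dotv u (delta_mx ord0 j) = u ord0 j.
Proof.
rewrite /dotv (bigD1 j)//= mxE !eqxx mulr1 big1 ?addr0// => l lj.
by rewrite mxE (negbTE lj) andbF mulr0.
Qed.

Lemma dotv_mulmx u O x : dotv (u *m O) x = dotv u (x *m O^T).
Proof. by rewrite !dotvE trmx_mul trmxK mulmxA. Qed.

Lemma enorm_sqr u : enorm u ^+ 2 = dotv u u.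
Proof. by rewrite sqr_sqrtr// dotv_ge0. Qed.

Lemma direction_dotv u : u != 0 -> dotv (direction u) (direction u) = 1.
Proof.
move=> u0; have e0 : enorm u != 0 by rewrite sqrtr_eq0 -ltNge lt0r dotv_eq0 u0 dotv_ge0.
rewrite /direction dotvZl dotvZr -enorm_sqr; field.
exact: e0.
Qed.

Lemma direction0 : direction (0 : 'rV[R]_k) = 0.
Proof. by rewrite /direction scaler0. Qed.

Lemma direction_coord u j : `|direction u ord0 j| <= 1.
Proof.
have [->|u0] := eqVneq u 0; first by rewrite direction0 mxE normr0.
rewrite -(@ler_pXn2r _ 2%N)// ?nnegrE// expr1n real_normK ?num_real//.
rewrite -(direction_dotv u0) /dotv (bigD1 j)//= expr2 lerDl.
by apply: sumr_ge0 => l _; rewrite -expr2 sqr_ge0.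
Qed.

(* The Householder reflection along x - y swaps x and y. *)
Lemma reflection x y : dotv x x = dotv y y ->
  exists2 O, orthogonal_mx O & x *m O^T = y.
Proof.
move=> xy; have [->|nxy] := eqVneq x y.
  by exists 1%:M; rewrite /orthogonal_mx trmx1 mulmx1.
pose v := x - y; have v0 : dotv v v != 0 by rewrite dotv_eq0 subr_eq0.
pose O := 1%:M - (2 / dotv v v) *: (v^T *m v).
have OT : O^T = O by rewrite /O linearB /= linearZ /= trmx1 trmx_mul trmxK.
have vv : v *m v^T = (dotv v v)%:M by rewrite [LHS]mx11_scalar -dotvE.
have xv : x *m v^T = (dotv v v / 2)%:M.
  rewrite [LHS]mx11_scalar -dotvE; congr (_%:M).
  rewrite /v dotvBr !dotvBl !dotvBr (dotvC y x) -xy; by field.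
exists O; rewrite ?/orthogonal_mx OT.
  rewrite {1}/O mulmxBl mul1mx -scalemxAl -mulmxA.
  have -> : v *m O = - v.
    rewrite /O mulmxBr mulmx1 -scalemxAr mulmxA vv mul_scalar_mx scalerA.
    by rewrite divfK// scaler_nat mulr2n opprD addrA subrr add0r.
  by rewrite mulmxN scalerN opprK /O subrK.
rewrite /O mulmxBr mulmx1 -scalemxAr mulmxA xv mul_scalar_mx scalerA.
have -> : 2 / dotv v v * (dotv v v / 2) = 1 by field.
by rewrite scale1r /v opprB addrC subrK.
Qed.

Lemma bdm_dotv (d : measure_display) (T : measurableType d) (Z : T -> 'rV[R]_k) x :
  (forall j, bdm (fun w => Z w ord0 j)) -> bdm (fun w => dotv (Z w) x).
Proof. by move=> bZ; apply: bdm_sum => j _; apply: bdmM => //; exact: bdm_cst. Qed.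

Lemma bdm_direction_coord j : bdm (fun v : rvT k => direction v ord0 j : R).
Proof.
split; last by exists 1 => v; exact: direction_coord.
(* Real powers are measurable on the whole line, which gives measurability of the inverse norm. At
   the zero vector both conventions yield 0. *)
have -> : (fun v : rvT k => direction v ord0 j : R) =
    (fun v => (dotv v v) `^ (2^-1) `^ (-1) * v ord0 j).
  apply/funext => v; rewrite mxE; congr (_ * _).
  by rewrite powR12_sqrt ?dotv_ge0// powR_inv1// sqrtr_ge0.
apply: measurable_funM; last exact: measurable_coord.
apply: (measurableT_comp (measurable_powR _)).
apply: (measurableT_comp (measurable_powR _)).
apply: measurable_sum => l; apply: measurable_funM; exact: measurable_coord.
Qed.

End dot_product.

(** * Moments of a uniform direction *)

Section sphere_moments.
Context {R : realType} {d : measure_display} {T : measurableType d}.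
Variables (P : probability T R) (k : nat) (U : T -> 'rV[R]_k).
Hypotheses (k0 : (0 < k)%N) (bU : forall j, bdm (fun w => U w ord0 j)).
Hypothesis sU : uniform_on_sphere P U.

Lemma uniform_Ex_mulmx (O : 'M[R]_k) (phi : rvT k -> R) :
  orthogonal_mx O -> measurable_fun setT phi ->
  Ex P (fun w => phi (U w)) = Ex P (fun w => phi (U w *m O)).
Proof.
move=> oO mphi; have [_ inv] := sU.
have mU : measurable_fun setT (U : T -> rvT k).
  by apply: measurable_rvP => j; case: (bU j).
have mUO : measurable_fun setT ((fun w => U w *m O) : T -> rvT k).
  apply: measurable_rvP => j; have [] : bdm (fun w => (U w *m O) ord0 j) => //.
  apply: (@eq_bdm _ _ _ (fun w => \sum_l U w ord0 l * O l j)).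
    by move=> w; rewrite mxE.
  by apply: bdm_sum => l _; apply: bdmM => //; exact: bdm_cst.
apply: Ex_law; [exact: (measurableT_comp mphi mU)|exact: (measurableT_comp mphi mUO)|].
move=> B mB; apply: (inv O oO (phi @^-1` B)).
by have := mphi measurableT B mB; rewrite setTI.
Qed.

Lemma measurable_dotvr (x : 'rV[R]_k) : measurable_fun setT (fun v : rvT k => dotv v x).
Proof.
by apply: measurable_sum => j; apply: measurable_funM => //; exact: measurable_coord.
Qed.

(** A reflection carries [x] to [y] and preserves the law of [U], so the moments of a projection
    depend on the length of the vector only. *)
Lemma uniform_Ex_dotvX x y m : dotv x x = dotv y y ->
  Ex P (fun w => dotv (U w) x ^+ m) = Ex P (fun w => dotv (U w) y ^+ m).
Proof.
move=> /reflection [Q oQ <-].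
rewrite (@uniform_Ex_mulmx Q (fun v => dotv v x ^+ m))//; last first.
  by apply: measurable_funX; exact: measurable_dotvr.
by apply: eq_Ex => w; rewrite dotv_mulmx.
Qed.

Lemma uniform_Ex_odd (phi : rvT k -> R) : bdm (fun w => phi (U w)) ->
  measurable_fun setT phi -> (forall v, phi (- v) = - phi v) ->
  Ex P (fun w => phi (U w)) = 0.
Proof.
move=> bphi mphi phiN.
have : Ex P (fun w => phi (U w)) = - Ex P (fun w => phi (U w)).
  rewrite -ExN// (@uniform_Ex_mulmx (- 1%:M))//.
    by apply: eq_Ex => w; rewrite mulmxN mulmx1 phiN.
  by rewrite /orthogonal_mx linearN/= trmx1 mulmxN mulNmx opprK mulmx1.
by move=> /eqP; rewrite -addr_eq0 -mulr2n mulrn_eq0/= => /eqP.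
Qed.

Lemma uniform_Ex_dotv x : Ex P (fun w => dotv (U w) x) = 0.
Proof.
apply: (@uniform_Ex_odd (fun v => dotv v x)).
- exact: bdm_dotv.
- exact: measurable_dotvr.
- by move=> v; rewrite -scaleN1r dotvZl mulN1r.
Qed.

Lemma uniform_Ex_dotv3 x y z :
  Ex P (fun w => dotv (U w) x * dotv (U w) y * dotv (U w) z) = 0.
Proof.
apply: (@uniform_Ex_odd (fun v => dotv v x * dotv v y * dotv v z)).
- by apply: bdmM; [apply: bdmM|]; exact: bdm_dotv.
- by apply: measurable_funM; [apply: measurable_funM|]; exact: measurable_dotvr.
- by move=> v; rewrite -scaleN1r !dotvZl; ring.
Qed.

Lemma uniform_ae : \forall w \ae P, dotv (U w) (U w) = 1.
Proof.
have [P1 _] := sU.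
have mn : measurable [set w | enorm (U w) = 1].
  rewrite (_ : [set w | _] = (fun w => dotv (U w) (U w)) @^-1` [set 1]).
    have [m _] : bdm (fun w => dotv (U w) (U w)).
      by apply: bdm_sum => j _; exact: bdmM.
    by have := m measurableT [set 1] (measurable_set1 _); rewrite setTI.
  apply/seteqP; split => w /= h; first by rewrite -enorm_sqr h expr1n.
  by rewrite /enorm h sqrtr1.
exists (~` [set w | enorm (U w) = 1]); split.
- exact: measurableC.
- by rewrite probability_setC// P1 subee.
- by move=> w /= h e; apply: h; rewrite -enorm_sqr e expr1n.
Qed.

Let e0 : 'rV[R]_k := delta_mx ord0 (Ordinal k0).

Lemma uniform_Ex_even x m :
  Ex P (fun w => dotv (U w) x ^+ (2 * m)) =
  dotv x x ^+ m * Ex P (fun w => dotv (U w) e0 ^+ (2 * m)).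
Proof.
rewrite (@uniform_Ex_dotvX x (enorm x *: e0)); last first.
  by rewrite dotvZl dotvZr dotv_delta mxE !eqxx mulr1 -expr2 enorm_sqr.
rewrite -enorm_sqr -exprM -ExZ.
  by apply: eq_Ex => w; rewrite dotvZr exprMn.
by apply: bdmX; exact: bdm_dotv.
Qed.

Lemma dotv_delta2 (j l : 'I_k) (c : R) : j != l ->
  dotv (delta_mx ord0 j + c *: delta_mx ord0 l) (delta_mx ord0 j + c *: delta_mx ord0 l)
  = 1 + c ^+ 2.
Proof.
move=> jl; rewrite dotvDr dotvZr !dotv_delta !mxE !eqxx (negbTE jl) eq_sym (negbTE jl).
by rewrite /= mulr0 addr0 mulr1 add0r expr2.
Qed.

(** All coordinates share one second moment and their squares sum to 1 almost surely, so this moment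
    is 1/k. Polarization passes from squares to products. *)
Lemma uniform_Ex_dotv2 x y :
  Ex P (fun w => dotv (U w) x * dotv (U w) y) = dotv x y / k%:R.
Proof.
have kR0 : k%:R != 0 :> R by rewrite pnatr_eq0 -lt0n.
set c := Ex P (fun w => dotv (U w) e0 ^+ (2 * 1)).
have c2 : c = k%:R^-1.
  apply: (@mulfI _ k%:R) => //; rewrite divff//.
  transitivity (Ex P (fun w => dotv (U w) (U w))); last first.
    rewrite -[RHS](Ex_cst P 1); apply: Ex_ae => //; last exact: uniform_ae.
      by apply: bdm_sum => j _; exact: bdmM.
    exact: bdm_cst.
  rewrite Ex_sum => [|j _]; last exact: bdmM.
  transitivity (\sum_(j < k) c); first by rewrite sumr_const card_ord mulr_natl.
  apply: eq_bigr => j _; transitivity (Ex P (fun w => dotv (U w) (delta_mx ord0 j) ^+ (2 * 1))).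
    by rewrite uniform_Ex_even dotv_delta mxE !eqxx mul1r.
  by apply: eq_Ex => w; rewrite dotv_delta.
have bx := bdm_dotv x bU; have by_ := bdm_dotv y bU.
have bxy := bdm_dotv (x + y) bU; have bxy' := bdm_dotv (x - y) bU.
transitivity (4^-1 * Ex P (fun w => dotv (U w) (x + y) ^+ (2 * 1))
  - 4^-1 * Ex P (fun w => dotv (U w) (x - y) ^+ (2 * 1))).
  rewrite -!ExZ ?muln1 -?ExB; [|bdm|bdm|bdm|bdm].
  by apply: eq_Ex => w; rewrite dotvDr dotvBr; field.
have sD : dotv (x + y) (x + y) = dotv x x + 2 * dotv x y + dotv y y.
  by rewrite dotvDr !dotvDl (dotvC y x); ring.
have sB : dotv (x - y) (x - y) = dotv x x - 2 * dotv x y + dotv y y.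
  by rewrite dotvBr !dotvBl (dotvC y x); ring.
rewrite (uniform_Ex_even (x + y)) (uniform_Ex_even (x - y)) -/c c2 !expr1 sD sB.
by field.
Qed.

(* With c = E <U, e>^4, expanding <U, e_j + e_l>^4 + <U, e_j - e_l>^4 gives
   E U_j^2 U_l^2 = c / 3 for j <> l; summing over j, l bounds c by 3 / k^2. *)
Lemma uniform_Ex_dotv4 x :
  Ex P (fun w => dotv (U w) x ^+ 4) <= 3 / k%:R ^+ 2 * dotv x x ^+ 2.
Proof.
have kR0 : 0 < k%:R ^+ 2 :> R by rewrite exprn_gt0// ltr0n.
rewrite -[4%N]/(2 * 2)%N uniform_Ex_even mulrC; apply: ler_wpM2r; first exact: sqr_ge0.
set c := Ex P _; rewrite ler_pdivlMr//.
have c0 : 0 <= c by apply: Ex_ge0 => w; rewrite exprM exprn_ge0// sqr_ge0.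
have c4 j l : c / 3 <= Ex P (fun w => U w ord0 j ^+ 2 * U w ord0 l ^+ 2).
  have bj := bU j; have bl := bU l.
  have cj i : Ex P (fun w => U w ord0 i ^+ 4) = c.
    transitivity (Ex P (fun w => dotv (U w) (delta_mx ord0 i) ^+ (2 * 2))).
      by apply: eq_Ex => w; rewrite dotv_delta.
    by rewrite uniform_Ex_even dotv_delta mxE !eqxx expr1n mul1r.
  have [<-|jl] := eqVneq j l.
    rewrite (_ : Ex _ _ = c); first by lra.
    by rewrite -(cj j); apply: eq_Ex => w; ring.
  have E (e : R) : e ^+ 2 = 1 ->
      Ex P (fun w => (U w ord0 j + e * U w ord0 l) ^+ 4) = 4 * c.
    move=> e1; transitivity (Ex P (fun w =>
        dotv (U w) (delta_mx ord0 j + e *: delta_mx ord0 l) ^+ (2 * 2))).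
      by apply: eq_Ex => w; rewrite dotvDr dotvZr !dotv_delta.
    by rewrite uniform_Ex_even dotv_delta2// e1 -/c; ring.
  have := E 1 (expr1n _ _); have : Ex P (fun w => (U w ord0 j - U w ord0 l) ^+ 4) = 4 * c.
    by rewrite -(E (-1)) ?sqrrN ?expr1n//; apply: eq_Ex => w; rewrite mulN1r.
  move=> E1 E2; have : 8 * c = Ex P (fun w => (U w ord0 j - U w ord0 l) ^+ 4) +
      Ex P (fun w => (U w ord0 j + 1 * U w ord0 l) ^+ 4) by rewrite E1 E2; ring.
  rewrite -ExD; [|bdm|bdm].
  rewrite (@eq_Ex _ _ _ _ _ (fun w => (2 * U w ord0 j ^+ 4 + 2 * U w ord0 l ^+ 4) +
    12 * (U w ord0 j ^+ 2 * U w ord0 l ^+ 2))); last by move=> w; ring.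
  rewrite ExD; [|bdm|bdm]; rewrite ExD; [|bdm|bdm].
  by rewrite !ExZ ?cj; [lra|bdm|bdm|bdm].
have : Ex P (fun w => dotv (U w) (U w) ^+ 2) = 1.
  rewrite -[RHS](Ex_cst P 1); apply: Ex_ae.
  - by apply: bdmX; apply: bdm_sum => j _; exact: bdmM.
  - exact: bdm_cst.
  - by apply: filterS uniform_ae => w ->; rewrite expr1n.
rewrite (@eq_Ex _ _ _ _ _ (fun w => \sum_(j < k) \sum_(l < k)
    (U w ord0 j ^+ 2 * U w ord0 l ^+ 2))); last first.
  move=> w; rewrite expr2 mulr_suml; apply: eq_bigr => j _.
  by rewrite mulr_sumr; apply: eq_bigr => l _; rewrite -!expr2.
have bjl j l : bdm (fun w => U w ord0 j ^+ 2 * U w ord0 l ^+ 2).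
  by apply: bdmM; apply: bdmX.
rewrite Ex_sum => [S1|j _]; last exact: bdm_sum.
have : \sum_(j < k) \sum_(l < k) (c / 3) <= 1.
  rewrite -[leRHS]S1; apply: ler_sum => j _; rewrite Ex_sum => [|l _]; last exact: bjl.
  by apply: ler_sum => l _; exact: c4.
rewrite !sumr_const card_ord -(mulr_natr (c / 3 *+ k) k) -(mulr_natr (c / 3) k).
by rewrite -mulrA -expr2; lra.
Qed.

End sphere_moments.

(** * Integrating out one vector with the others frozen *)

Section separable.
Context {R : realType} {d : measure_display} {T : measurableType d}.
Variable P : probability T R.
Context {I : finType} {k : nat} (W : I -> T -> 'rV[R]_k).
Hypothesis rW : forall i, random_vector (W i).
Hypothesis iW : mutually_indep P W.
Variable i : I.
Local Notation rvT := (@rvT R).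

(* Finite sums of products phi(v) psi(w) with psi independent of [W i]: for
   these, Fubini's theorem is linearity of the expectation. *)
Inductive separable : (rvT k -> T -> R) -> Prop :=
| Separable1 phi psi : bdm phi -> free W i psi ->
    separable (fun v w => phi v * psi w)
| SeparableD K L : separable K -> separable L ->
    separable (fun v w => K v w + L v w).

Lemma eq_separable K L : (forall v w, K v w = L v w) -> separable K -> separable L.
Proof. by move=> KL; rewrite (_ : K = L)//; apply/funext => v; apply/funext. Qed.

Lemma separable_l phi : bdm phi -> separable (fun v _ => phi v).
Proof.
move=> bphi; apply: eq_separable (Separable1 bphi (bdm_cst 1)) => v w.
by rewrite mulr1.
Qed.

Lemma separable_r psi : free W i psi -> separable (fun _ w => psi w).
Proof.
move=> fpsi; apply: eq_separable (Separable1 (bdm_cst 1) fpsi) => v w.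
by rewrite mul1r.
Qed.

Lemma separableM K L : separable K -> separable L ->
  separable (fun v w => K v w * L v w).
Proof.
move=> sK sL; elim: sK => [phi psi bphi fpsi|K1 K2 _ IH1 _ IH2]; last first.
  by apply: eq_separable (SeparableD IH1 IH2) => v w; rewrite mulrDl.
elim: sL => [phi' psi' bphi' fpsi'|L1 L2 _ IH1 _ IH2]; last first.
  by apply: eq_separable (SeparableD IH1 IH2) => v w; rewrite mulrDr.
apply: eq_separable (Separable1 (bdmM bphi bphi') (bdmM fpsi fpsi')) => v w.
by rewrite mulrACA.
Qed.

Lemma separable_sum (J : Type) (r : seq J) (K : J -> rvT k -> T -> R) :
  (forall j, separable (K j)) -> separable (fun v w => \sum_(j <- r) K j v w).
Proof.
move=> sK; elim: r => [|j r IH].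
  by apply: eq_separable (separable_l (bdm_cst 0)) => v w; rewrite big_nil.
by apply: eq_separable (SeparableD (sK j) IH) => v w; rewrite big_cons.
Qed.

(** The boundedness claims accompany the identity because the induction splits expectations of sums,
    which requires them for both summands. *)
Lemma separable_fubini K : separable K ->
  [/\ bdm (fun w => K (W i w) w), forall w', bdm (fun w => K (W i w) w'),
    bdm (fun w' => Ex P (fun w => K (W i w) w')) &
    Ex P (fun w => K (W i w) w) = Ex P (fun w' => Ex P (fun w => K (W i w) w'))].
Proof.
elim=> [phi psi bphi fpsi|K1 K2 _ [b1 c1 d1 e1] _ [b2 c2 d2 e2]].
  have bW := bdm_rv rW i bphi; have bpsi := free_bdm rW fpsi.
  have cW w' : bdm (fun w => phi (W i w) * psi w').
    by apply: bdmM => //; exact: bdm_cst.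
  have E w' : Ex P (fun w => phi (W i w) * psi w') =
      Ex P (fun w => phi (W i w)) * psi w'.
    by rewrite mulrC -ExZ//; apply: eq_Ex => w; rewrite mulrC.
  split => //.
  - exact: bdmM.
  - by apply: eq_bdm (bdmM (bdm_cst _) bpsi) => w'; rewrite E.
  - by rewrite (Ex_free rW iW bphi fpsi) -ExZ//; apply: eq_Ex => w'; rewrite E.
split.
- exact: bdmD.
- by move=> w'; exact: bdmD.
- by apply: eq_bdm (bdmD d1 d2) => w'; rewrite ExD.
- by rewrite ExD// e1 e2 -ExD//; apply: eq_Ex => w'; rewrite ExD.
Qed.

Lemma Ex_separable K : separable K ->
  Ex P (fun w => K (W i w) w) = Ex P (fun w' => Ex P (fun w => K (W i w) w')).
Proof. by move=> /separable_fubini[]. Qed.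

End separable.

(** * Moments of the product kernel *)

Section direction_kernel.
Context {R : realType} {d : measure_display} {T : measurableType d}.
Variables (P : probability T R) (n p q : nat).
Variables (X : 'I_n -> T -> 'rV[R]_p) (Y : 'I_n -> T -> 'rV[R]_q).
Hypotheses (p0 : (0 < p)%N) (q0 : (0 < q)%N).
Hypothesis iidXY : iid P (fun (i : 'I_n) w => row_mx (X i w) (Y i w)).
Hypothesis rvXY : forall i, random_vector (X i) /\ random_vector (Y i).
Hypothesis indXY : forall i, indep2 P (X i) (Y i).
Hypothesis sphXY : forall i, spherical_directions P (X i) /\ spherical_directions P (Y i).

Local Notation rvT := (@rvT R).
Let W (i : 'I_n) w := row_mx (X i w) (Y i w).
Let U i w := direction (X i w).
Let V i w := direction (Y i w).
Let rW : forall i, random_vector (W i) := proj1 iidXY.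
Let iW : mutually_indep P W := proj1 (proj2 iidXY).

Definition dir_kernel (i j : 'I_n) w := dotv (U i w) (U j w) * dotv (V i w) (V j w).
Local Notation g := dir_kernel.

(** Mutual independence concerns the concatenated vectors [W i], so functions of [X i] have to be
    read as functions of [W i]. *)
Lemma bdm_lsubmx (phi : rvT p -> R) : bdm phi ->
  bdm (fun v : rvT (p + q) => phi (lsubmx (v : 'rV[R]_(p + q)))).
Proof.
move=> [mphi [M phiM]]; split; last by exists M => v.
apply: (measurableT_comp mphi); apply: measurable_rvP => j.
rewrite (_ : (fun _ => _) = (fun v : rvT (p + q) => v ord0 (lshift q j))).
  exact: measurable_coord.
by apply/funext => v; rewrite mxE.
Qed.

Lemma bdm_rsubmx (phi : rvT q -> R) : bdm phi ->
  bdm (fun v : rvT (p + q) => phi (rsubmx (v : 'rV[R]_(p + q)))).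
Proof.
move=> [mphi [M phiM]]; split; last by exists M => v.
apply: (measurableT_comp mphi); apply: measurable_rvP => j.
rewrite (_ : (fun _ => _) = (fun v : rvT (p + q) => v ord0 (rshift p j))).
  exact: measurable_coord.
by apply/funext => v; rewrite mxE.
Qed.

Lemma free_U i j a : j != i -> free W i (fun w => U j w ord0 a).
Proof.
move=> ji; apply: eq_bdm (free_rv W ji (bdm_lsubmx (bdm_direction_coord a))) => w.
by rewrite row_mxKl.
Qed.

Lemma free_V i j a : j != i -> free W i (fun w => V j w ord0 a).
Proof.
move=> ji; apply: eq_bdm (free_rv W ji (bdm_rsubmx (bdm_direction_coord a))) => w.
by rewrite row_mxKr.
Qed.

Lemma bdm_U i a : bdm (fun w => U i w ord0 a).
Proof.
apply: eq_bdm (bdm_rv rW i (bdm_lsubmx (bdm_direction_coord a))) => w.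
by rewrite row_mxKl.
Qed.

Lemma bdm_V i a : bdm (fun w => V i w ord0 a).
Proof.
apply: eq_bdm (bdm_rv rW i (bdm_rsubmx (bdm_direction_coord a))) => w.
by rewrite row_mxKr.
Qed.

Lemma dir_kernel_bdm i j : bdm (g i j).
Proof.
by apply: bdmM; apply: bdm_sum => a _; apply: bdmM; (exact: bdm_U || exact: bdm_V).
Qed.

Lemma dir_kernel_free k i j : i != k -> j != k -> free W k (g i j).
Proof.
move=> ik jk.
by apply: bdmM; apply: bdm_sum => a _; apply: bdmM; (exact: free_U || exact: free_V).
Qed.

Lemma dir_kernelC i j w : g i j w = g j i w.
Proof. by rewrite /g dotvC (dotvC (V i w)). Qed.

(** A direction has length 1 only almost surely, since a zero vector has direction 0; the diagonal
    can be replaced by 1 under an expectation but not pointwise. *)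
Lemma dir_kernel_diag i (G : T -> R) : bdm G -> Ex P (fun w => g i i w * G w) = Ex P G.
Proof.
move=> bG; apply: Ex_ae => //; first by apply: bdmM => //; exact: dir_kernel_bdm.
have [[_ sX] [_ sY]] := sphXY i.
have aeU := uniform_ae (bdm_U i) sX; have aeV := uniform_ae (bdm_V i) sY.
by apply: filterS2 aeU aeV => w u v; rewrite /g u v !mul1r.
Qed.

(** The kernel at (i, j) split into two arguments: [v] is the value of the i-th pair, to be
    integrated, and [w] fixes the directions of index [j]. *)
Let Kd (j : 'I_n) (v : rvT (p + q)) w :=
  dotv (direction (lsubmx (v : 'rV[R]_(p + q)))) (U j w) *
  dotv (direction (rsubmx (v : 'rV[R]_(p + q)))) (V j w).

Let Kd_separable i j : j != i -> separable W i (Kd j).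
Proof.
move=> ji; apply: separableM; apply: separable_sum => a.
  apply: separableM; last by apply: separable_r; exact: free_U.
  by apply: separable_l; apply: (bdm_lsubmx (bdm_direction_coord a)).
apply: separableM; last by apply: separable_r; exact: free_V.
by apply: separable_l; apply: (bdm_rsubmx (bdm_direction_coord a)).
Qed.

Let KdE i j w w' : Kd j (W i w) w' = dotv (U i w) (U j w') * dotv (V i w) (V j w').
Proof. by rewrite /Kd row_mxKl row_mxKr. Qed.

Lemma Ex_UV i (phi : rvT p -> R) (psi : rvT q -> R) : bdm phi -> bdm psi ->
  Ex P (fun w => phi (X i w) * psi (Y i w)) =
  Ex P (fun w => phi (X i w)) * Ex P (fun w => psi (Y i w)).
Proof.
move=> bphi bpsi; have [rX rY] := rvXY i.
have mX : measurable_fun setT (X i : T -> rvT p) by exact: measurable_rvP.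
have mY : measurable_fun setT (Y i : T -> rvT q) by exact: measurable_rvP.
have [[mphi [M phiM]] [mpsi [N psiN]]] := (bphi, bpsi).
apply: Ex_indep.
- by split; [exact: (measurableT_comp mphi mX)|exists M => w].
- by split; [exact: (measurableT_comp mpsi mY)|exists N => w].
- move=> A B mA mB; apply: (@indXY i (phi @^-1` A) (psi @^-1` B)).
    by have := mphi measurableT A mA; rewrite setTI.
  by have := mpsi measurableT B mB; rewrite setTI.
Qed.

Let bUx (x : 'rV[R]_p) : bdm (fun v : rvT p => dotv (direction v) x).
Proof.
apply: (@bdm_dotv _ _ _ _ (fun v : rvT p => direction v)) => j.
exact: bdm_direction_coord.
Qed.

Let bVx (y : 'rV[R]_q) : bdm (fun v : rvT q => dotv (direction v) y).
Proof.
apply: (@bdm_dotv _ _ _ _ (fun v : rvT q => direction v)) => j.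
exact: bdm_direction_coord.
Qed.

Let Ex_UV' i c (phi : rvT p -> R) (psi : rvT q -> R) : bdm phi -> bdm psi ->
  Ex P (fun w => phi (X i w) * psi (Y i w) * c) =
  Ex P (fun w => phi (X i w)) * Ex P (fun w => psi (Y i w)) * c.
Proof.
move=> bphi bpsi; have [rX rY] := rvXY i.
have mX : measurable_fun setT (X i : T -> rvT p) by exact: measurable_rvP.
have mY : measurable_fun setT (Y i : T -> rvT q) by exact: measurable_rvP.
have [[mphi [M phiM]] [mpsi [N psiN]]] := (bphi, bpsi).
rewrite -Ex_UV// mulrC -ExZ; first by apply: eq_Ex => w; rewrite mulrC.
apply: bdmM.
- by split; [exact: (measurableT_comp mphi mX)|exists M => w].
- by split; [exact: (measurableT_comp mpsi mY)|exists N => w].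
Qed.

(** With the directions of [j] frozen, independence of [X i] and [Y i] factors the integral; the
    factor linear in [U i] is already 0. *)
Lemma dir_kernel_moment1 i j G : j != i -> free W i G ->
  Ex P (fun w => g i j w * G w) = 0.
Proof.
move=> ji fG; have [[_ sX] _] := sphXY i.
rewrite (@eq_Ex _ _ _ _ _ (fun w => Kd j (W i w) w * G w)); last first.
  by move=> w; rewrite KdE.
have sK := separableM (Kd_separable ji) (separable_r fG).
rewrite (Ex_separable rW iW sK) -[RHS](Ex_cst P 0); apply: eq_Ex => w'.
under eq_Ex do rewrite KdE.
rewrite (@Ex_UV' i _ (fun v => dotv (direction v) (U j w'))
  (fun v => dotv (direction v) (V j w')))//.
by rewrite (uniform_Ex_dotv (bdm_U i) sX) !mul0r.
Qed.

(** Second moments of the two directions contract the kernels at (i, j) and (i, k) to the kernel at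
    (j, k), with a factor 1/p from [U i] and 1/q from [V i]. The case j = k is included and gives
    the variance through the diagonal. *)
Lemma dir_kernel_moment2 i j k G : j != i -> k != i -> free W i G ->
  Ex P (fun w => g i j w * g i k w * G w) =
  Ex P (fun w => g j k w * G w) / (p * q)%:R.
Proof.
move=> ji ki fG; have [[_ sX] [_ sY]] := sphXY i.
have bG := free_bdm rW fG.
rewrite (@eq_Ex _ _ _ _ _ (fun w => Kd j (W i w) w * Kd k (W i w) w * G w)); last first.
  by move=> w; rewrite !KdE.
have sK := separableM (separableM (Kd_separable ji) (Kd_separable ki)) (separable_r fG).
rewrite (Ex_separable rW iW sK) mulrC -ExZ; last first.
  by apply: bdmM => //; exact: dir_kernel_bdm.
apply: eq_Ex => w'.
rewrite (@eq_Ex _ _ _ _ _ (fun w => (dotv (U i w) (U j w') * dotv (U i w) (U k w')) *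
  (dotv (V i w) (V j w') * dotv (V i w) (V k w')) * G w')); last first.
  by move=> w; rewrite !KdE; ring.
rewrite (@Ex_UV' i _ (fun v => dotv (direction v) (U j w') * dotv (direction v) (U k w'))
  (fun v => dotv (direction v) (V j w') * dotv (direction v) (V k w'))); last 2 first.
- by apply: bdmM.
- by apply: bdmM.
rewrite (uniform_Ex_dotv2 p0 (bdm_U i) sX) (uniform_Ex_dotv2 q0 (bdm_V i) sY).
by rewrite /g natrM invfM; ring.
Qed.

(** The symmetry of [U i] under sign change kills one of the two factors; [j], [k], [l] may
    coincide. *)
Lemma dir_kernel_moment3 i j k l G : j != i -> k != i -> l != i -> free W i G ->
  Ex P (fun w => g i j w * g i k w * g i l w * G w) = 0.
Proof.
move=> ji ki li fG; have [[_ sX] _] := sphXY i.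
rewrite (@eq_Ex _ _ _ _ _ (fun w =>
    Kd j (W i w) w * Kd k (W i w) w * Kd l (W i w) w * G w)); last first.
  by move=> w; rewrite !KdE.
have sK := separableM (separableM (separableM (Kd_separable ji) (Kd_separable ki))
  (Kd_separable li)) (separable_r fG).
rewrite (Ex_separable rW iW sK) -[RHS](Ex_cst P 0); apply: eq_Ex => w'.
rewrite (@eq_Ex _ _ _ _ _ (fun w =>
  (dotv (U i w) (U j w') * dotv (U i w) (U k w') * dotv (U i w) (U l w')) *
  (dotv (V i w) (V j w') * dotv (V i w) (V k w') * dotv (V i w) (V l w')) * G w')); last first.
  by move=> w; rewrite !KdE; ring.
rewrite (@Ex_UV' i _ (fun v => dotv (direction v) (U j w') * dotv (direction v) (U k w')
    * dotv (direction v) (U l w'))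
  (fun v => dotv (direction v) (V j w') * dotv (direction v) (V k w')
    * dotv (direction v) (V l w'))); last 2 first.
- by do 2 apply: bdmM => //.
- by do 2 apply: bdmM => //.
by rewrite (uniform_Ex_dotv3 (bdm_U i) sX) !mul0r.
Qed.

Let dotv_direction_le1 m (v : 'rV[R]_m) : dotv (direction v) (direction v) <= 1.
Proof.
have [->|v0] := eqVneq v 0; last by rewrite direction_dotv.
by rewrite direction0 /dotv big1// => a _; rewrite mxE mul0r.
Qed.

Lemma dir_kernel_moment4 i j : j != i ->
  Ex P (fun w => g i j w ^+ 4) <= 9 / (p * q)%:R ^+ 2.
Proof.
move=> ji; have [[_ sX] [_ sY]] := sphXY i.
rewrite (@eq_Ex _ _ _ _ _ (fun w =>
    (Kd j (W i w) w * Kd j (W i w) w) * (Kd j (W i w) w * Kd j (W i w) w))); last first.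
  by move=> w; rewrite !KdE /g; ring.
have sK2 := separableM (Kd_separable ji) (Kd_separable ji).
have sK := separableM sK2 sK2.
have [_ _ bK ->] := separable_fubini rW iW sK.
have KE w' : Ex P (fun w => Kd j (W i w) w' * Kd j (W i w) w' *
    (Kd j (W i w) w' * Kd j (W i w) w')) = Ex P (fun w => dotv (U i w) (U j w') ^+ 4) *
    Ex P (fun w => dotv (V i w) (V j w') ^+ 4).
  rewrite -(@Ex_UV i (fun v => dotv (direction v) (U j w') ^+ 4)
    (fun v => dotv (direction v) (V j w') ^+ 4)); [|exact: bdmX|exact: bdmX].
  by apply: eq_Ex => w; rewrite KdE; ring.
have le w' : Ex P (fun w => dotv (U i w) (U j w') ^+ 4) *
    Ex P (fun w => dotv (V i w) (V j w') ^+ 4) <= 9 / (p * q)%:R ^+ 2.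
  have -> : 9 / (p * q)%:R ^+ 2 = (3 / p%:R ^+ 2) * (3 / q%:R ^+ 2) :> R.
    by rewrite natrM exprMn invfM; ring.
  apply: ler_pM.
  - by apply: Ex_ge0 => w; rewrite (exprM _ 2 2) sqr_ge0.
  - by apply: Ex_ge0 => w; rewrite (exprM _ 2 2) sqr_ge0.
  - apply: (le_trans (uniform_Ex_dotv4 p0 (bdm_U i) sX _)).
    rewrite ler_piMr ?divr_ge0 ?exprn_ge0//.
    by rewrite exprn_ile1// ?dotv_ge0//; exact: dotv_direction_le1.
  - apply: (le_trans (uniform_Ex_dotv4 q0 (bdm_V i) sY _)).
    rewrite ler_piMr ?divr_ge0 ?exprn_ge0//.
    by rewrite exprn_ile1// ?dotv_ge0//; exact: dotv_direction_le1.
rewrite -[leRHS](Ex_cst P); apply: Ex_le => //; first exact: bdm_cst.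
by move=> w'; rewrite KE.
Qed.

End direction_kernel.

(** * The leave-one-out expansion *)

Ltac Ex_linear := rewrite -?ExZ; try (by bdm); rewrite -?ExD; try (by bdm);
  apply: eq_Ex => ?; try ring.

Section kernel_sum.
Context {R : realType} {d : measure_display} {T : measurableType d}.
Variables (P : probability T R) (n : nat) (D : R) (g : 'I_n -> 'I_n -> T -> R).
(** From here on only moment identities of a symmetric kernel are kept: [D] stands for pq, [F i] for
    the pi-system [others] of the index [i], and [g0] to [g4] for the facts just proved. *)
Variable F : 'I_n -> set (set T).
Local Notation fr i := (sub_bdm (F i)).

Hypotheses (n0 : (0 < n)%N) (D0 : 0 < D).
Hypothesis fr_bdm : forall i (G : T -> R), fr i G -> bdm G.
Hypothesis gC : forall i j w, g i j w = g j i w.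
Hypothesis gb : forall i j, bdm (g i j).
Hypothesis gf : forall k i j, i != k -> j != k -> fr k (g i j).
Hypothesis g1 : forall i j G, j != i -> fr i G -> Ex P (fun w => g i j w * G w) = 0.
Hypothesis g2 : forall i j k G, j != i -> k != i -> fr i G ->
  Ex P (fun w => g i j w * g i k w * G w) = Ex P (fun w => g j k w * G w) / D.
Hypothesis g3 : forall i j k l G, j != i -> k != i -> l != i -> fr i G ->
  Ex P (fun w => g i j w * g i k w * g i l w * G w) = 0.
Hypothesis g4 : forall i j, j != i -> Ex P (fun w => g i j w ^+ 4) <= 9 / D ^+ 2.
Hypothesis g0 : forall i G, bdm G -> Ex P (fun w => g i i w * G w) = Ex P G.

Let sc : R := Num.sqrt (2 * D) / n%:R.
(** [c] is the variance of an off-diagonal scaled entry. Next, [k4] bounds its fourth moment: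
    [sc ^+ 4] is 4 D^2 / n^4, and the kernel contributes 9 / D^2. *)
Let c : R := 2 / n%:R ^+ 2.
Let k4 : R := 36 / n%:R ^+ 4.
Let nR0 : n%:R != 0 :> R. Proof. by rewrite pnatr_eq0 -lt0n. Qed.
Let nRp : 0 < n%:R :> R. Proof. by rewrite ltr0n. Qed.
Let c0 : 0 <= c. Proof. by rewrite divr_ge0// exprn_ge0// ltW. Qed.
Let k40 : 0 <= k4. Proof. by rewrite divr_ge0// exprn_ge0// ltW. Qed.

Let sc2 : sc ^+ 2 = c * D.
Proof.
rewrite /sc /c exprMn sqr_sqrtr ?mulr_ge0// ?ltW//.
by rewrite exprVn; ring.
Qed.

Definition scaled_kernel i j w := sc * g i j w.
Local Notation a := scaled_kernel.

Let ab i j : bdm (a i j). Proof. by apply: bdmM => //; exact: bdm_cst. Qed.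

Let af k i j : i != k -> j != k -> fr k (a i j).
Proof. by move=> ik jk; apply: bdmM; [exact: bdm_cst|exact: gf]. Qed.

Let aC i j w : a i j w = a j i w. Proof. by rewrite /a gC. Qed.

Let a1 i j G : j != i -> fr i G -> Ex P (fun w => a i j w * G w) = 0.
Proof.
move=> ji fG; have bG := fr_bdm fG; have bg := gb i j.
transitivity (sc * Ex P (fun w => g i j w * G w)); last by rewrite g1// mulr0.
by rewrite /a; Ex_linear.
Qed.

Let a2 i j k G : j != i -> k != i -> fr i G ->
  Ex P (fun w => a i j w * a i k w * G w) = c * Ex P (fun w => g j k w * G w).
Proof.
move=> ji ki fG; have bG := fr_bdm fG; have bg := gb i j; have bg' := gb i k.
transitivity (sc ^+ 2 * Ex P (fun w => g i j w * g i k w * G w)).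
  by rewrite /a; Ex_linear.
rewrite g2// sc2; field.
by rewrite gt_eqF.
Qed.

Let a22 i j G : j != i -> fr i G ->
  Ex P (fun w => a i j w ^+ 2 * G w) = c * Ex P G.
Proof. by move=> ji fG; rewrite -(g0 j (fr_bdm fG)) -(a2 ji ji fG). Qed.

Let a3 i j k l G : j != i -> k != i -> l != i -> fr i G ->
  Ex P (fun w => a i j w * a i k w * a i l w * G w) = 0.
Proof.
move=> ji ki li fG; have bG := fr_bdm fG.
have bg := gb i j; have bg' := gb i k; have bg'' := gb i l.
transitivity (sc ^+ 3 * Ex P (fun w => g i j w * g i k w * g i l w * G w)).
  by rewrite /a; Ex_linear.
by rewrite g3// mulr0.
Qed.

Let a4 i j : j != i -> Ex P (fun w => a i j w ^+ 4) <= k4.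
Proof.
move=> ji; have bg := gb i j.
have -> : Ex P (fun w => a i j w ^+ 4) = sc ^+ 4 * Ex P (fun w => g i j w ^+ 4).
  by rewrite /a; Ex_linear.
have -> : k4 = sc ^+ 4 * (9 / D ^+ 2).
  rewrite (exprM _ 2 2) sc2 /c /k4; field.
  by rewrite nR0 gt_eqF.
by apply: ler_wpM2l; [rewrite (exprM _ 2 2) sqr_ge0|exact: g4].
Qed.

(** A partial row sum over a list, so that moments follow by induction: the head index is
    independent of the sum over the tail. *)
Let Rs (s : seq 'I_n) i w := \sum_(j <- s) a i j w.

Let Rs_cons j s i w : Rs (j :: s) i w = a i j w + Rs s i w.
Proof. by rewrite /Rs big_cons. Qed.

Let Rb s i : bdm (Rs s i). Proof. by apply: bdm_sum. Qed.

Let Rf l s i : l \notin s -> i != l -> fr l (Rs s i).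
Proof.
elim: s => [|j s IH] ls il.
  by apply: eq_bdm (bdm_cst 0) => w; rewrite /Rs big_nil.
move: ls; rewrite inE negb_or => /andP[lj ls].
apply: eq_bdm (bdmD (af il _) (IH ls il)) => [w|]; last by rewrite eq_sym; exact: lj.
by rewrite Rs_cons.
Qed.

Let E2 s i : uniq s -> i \notin s -> Ex P (fun w => Rs s i w ^+ 2) = c * (size s)%:R.
Proof.
elim: s => [_ _|j s IH /= /andP[js us]].
  rewrite mulr0 -[RHS](Ex_cst P 0); apply: eq_Ex => w.
  by rewrite /Rs big_nil expr0n.
rewrite inE negb_or => /andP[ij is_]; have ba := ab j i; have bR := Rb s i.
(* The new index [j] is the one integrated out, so symmetry is used to make it the row index; then
   the cross term has mean 0. *)
have -> : Ex P (fun w => Rs (j :: s) i w ^+ 2) =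
    Ex P (fun w => a j i w ^+ 2 * 1) + 2 * Ex P (fun w => a j i w * Rs s i w)
    + Ex P (fun w => Rs s i w ^+ 2).
  by Ex_linear; rewrite Rs_cons (aC i j); ring.
rewrite a1//; last exact: Rf.
rewrite (@a22 j i (fun=> 1))//; last exact: bdm_cst.
by rewrite Ex_cst IH// -[(size s).+1]addn1 natrD; ring.
Qed.

(** With m indices present, a new one adds at most k4 + 6 c^2 m, its first and third powers having
    mean 0. The quadratic term absorbs this, as 3 (m+1)^2 - 3 m^2 >= 6 m. *)
Let E4 s i : uniq s -> i \notin s ->
  Ex P (fun w => Rs s i w ^+ 4) <= k4 * (size s)%:R + 3 * c ^+ 2 * (size s)%:R ^+ 2.
Proof.
elim: s => [_ _|j s IH /= /andP[js us]].
  rewrite mulr0 expr0n mulr0 addr0 -[leRHS](Ex_cst P 0).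
  rewrite (@eq_Ex _ _ _ _ _ (fun=> 0))// => w.
  by rewrite /Rs big_nil expr0n.
rewrite inE negb_or => /andP[ij is_]; have ba := ab j i; have bR := Rb s i.
have fR : fr j (Rs s i) by exact: Rf.
have -> : Ex P (fun w => Rs (j :: s) i w ^+ 4) =
    Ex P (fun w => a j i w ^+ 4)
    + 4 * Ex P (fun w => a j i w * a j i w * a j i w * Rs s i w)
    + 6 * Ex P (fun w => a j i w ^+ 2 * Rs s i w ^+ 2)
    + 4 * Ex P (fun w => a j i w * Rs s i w ^+ 3)
    + Ex P (fun w => Rs s i w ^+ 4).
  by Ex_linear; rewrite Rs_cons (aC i j); ring.
rewrite a3// a22//; last exact: bdmX.
rewrite a1//; last exact: bdmX.
rewrite E2//; have := a4 ij; have := IH us is_.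
rewrite -[(size s).+1]addn1 natrD; move: (size s)%:R => m.
have := mulr_ge0 c0 c0; move: (Ex _ _) (Ex _ _) => e1 e2 /=; rewrite !expr2; nra.
Qed.

Section pair.
Variables (i k : 'I_n).
Hypothesis ik : i != k.
(** Rows [i] and [k] share the entry at (i, k). It is kept apart so that the induction can extend
    both rows by the same index. *)
Let A s w := a i k w + Rs s i w.
Let B s w := a i k w + Rs s k w.

Let A2 s : uniq s -> i \notin s -> k \notin s ->
  Ex P (fun w => A s w ^+ 2) = c * ((size s)%:R + 1).
Proof.
move=> us is_ ks; rewrite -[_ + 1](natrD _ _ 1%N) addn1 -(@E2 (k :: s) i)/= ?ks//.
  by apply: eq_Ex => w; rewrite Rs_cons.
by rewrite inE negb_or ik.
Qed.

Let B2 s : uniq s -> i \notin s -> k \notin s ->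
  Ex P (fun w => B s w ^+ 2) = c * ((size s)%:R + 1).
Proof.
move=> us is_ ks; rewrite -[_ + 1](natrD _ _ 1%N) addn1 -(@E2 (i :: s) k)/= ?is_//.
  by apply: eq_Ex => w; rewrite Rs_cons /B aC.
by rewrite inE negb_or eq_sym ik.
Qed.

Let Ag s : bdm (A s). Proof. by apply: bdmD. Qed.
Let Bg s : bdm (B s). Proof. by apply: bdmD. Qed.

(** The triangle term. Without further indices it is a third moment, hence 0; each new [l] joins [i]
    to [k] and contributes c times the mean square 1/D of the kernel. *)
Let ABg s : uniq s -> i \notin s -> k \notin s ->
  Ex P (fun w => A s w * B s w * g i k w) = c * (size s)%:R / D.
Proof.
elim: s => [_ _ _|l s IH /= /andP[ls us]].
  rewrite mulr0 mul0r -[RHS](mulr0 (sc ^+ 2)).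
  rewrite -(@g3 i k k k (fun=> 1)); [|by rewrite eq_sym..|exact: bdm_cst].
  have bg := gb i k; Ex_linear.
  by rewrite /A /B /Rs !big_nil /a; ring.
rewrite !inE !negb_or => /andP[il is_] /andP[kl ks].
have fA : fr l (A s) by apply: bdmD; [exact: af|exact: Rf].
have fB : fr l (B s) by apply: bdmD; [exact: af|exact: Rf].
have fg : fr l (g i k) by exact: gf.
have bA := Ag s; have bB := Bg s; have bg := gb i k.
have ba := ab l i; have ba' := ab l k.
have -> : Ex P (fun w => A (l :: s) w * B (l :: s) w * g i k w) =
    Ex P (fun w => A s w * B s w * g i k w)
    + Ex P (fun w => a l i w * (B s w * g i k w))
    + Ex P (fun w => a l k w * (A s w * g i k w))
    + Ex P (fun w => a l i w * a l k w * g i k w).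
  by Ex_linear; rewrite /A /B !Rs_cons (aC i l) (aC k l); ring.
rewrite IH// a1//; last exact: bdmM.
rewrite a1//; last exact: bdmM.
rewrite a2// -[X in _ + c * X](_ : D^-1 = _); last first.
  rewrite -[LHS]mul1r -(Ex_cst P 1) -(@g0 k (fun=> 1)); last exact: bdm_cst.
  rewrite -(@g2 i k k)//; [|by rewrite eq_sym..|exact: bdm_cst].
  by apply: eq_Ex => w; rewrite mulr1.
by rewrite -[(size s).+1]addn1 natrD; ring.
Qed.

(** A new index multiplies two independent row variances (increment 2 c^2 (m+1)), closes triangles
    (4 c^2 m / D, by [ABg]) and adds one joint fourth moment, at most k4 by the inequality between
    arithmetic and geometric means. Terms odd in the new entries vanish. The three summands of the
    bound absorb these increments. *)
Lemma pair_moment22 s : uniq s -> i \notin s -> k \notin s ->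
  Ex P (fun w => (a i k w + Rs s i w) ^+ 2 * (a i k w + Rs s k w) ^+ 2) <= k4 * ((size s)%:R + 1)
    + c ^+ 2 * (size s)%:R * ((size s)%:R + 1) + 2 * c ^+ 2 * (size s)%:R ^+ 2 / D.
Proof.
rewrite -/(Ex P (fun w => A s w ^+ 2 * B s w ^+ 2)).
elim: s => [_ _ _|l s IH /= /andP[ls us]].
  rewrite expr0n !mulr0 !mul0r !addr0 add0r mulr1.
  apply: le_trans (@a4 i k _); last by rewrite eq_sym.
  rewrite le_eqVlt; apply/orP; left; apply/eqP; apply: eq_Ex => w.
  by rewrite /A /B /Rs !big_nil; ring.
rewrite !inE !negb_or => /andP[il is_] /andP[kl ks].
have fA : fr l (A s) by apply: bdmD; [exact: af|exact: Rf].
have fB : fr l (B s) by apply: bdmD; [exact: af|exact: Rf].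
have fA2 : fr l (fun w => A s w ^+ 2) by exact: bdmX.
have fB2 : fr l (fun w => B s w ^+ 2) by exact: bdmX.
have bA := Ag s; have bB := Bg s; have bg := gb i k.
have ba := ab l i; have ba' := ab l k.
have -> : Ex P (fun w => A (l :: s) w ^+ 2 * B (l :: s) w ^+ 2) =
    Ex P (fun w => A s w ^+ 2 * B s w ^+ 2)
    + 2 * Ex P (fun w => a l i w * (A s w * B s w ^+ 2))
    + 2 * Ex P (fun w => a l k w * (B s w * A s w ^+ 2))
    + Ex P (fun w => a l i w ^+ 2 * B s w ^+ 2)
    + Ex P (fun w => a l k w ^+ 2 * A s w ^+ 2)
    + 4 * Ex P (fun w => a l i w * a l k w * (A s w * B s w))
    + 2 * Ex P (fun w => a l i w * a l k w * a l k w * A s w)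
    + 2 * Ex P (fun w => a l i w * a l i w * a l k w * B s w)
    + Ex P (fun w => a l i w ^+ 2 * a l k w ^+ 2).
  by Ex_linear; rewrite /A /B !Rs_cons (aC i l) (aC k l); ring.
have fAB : fr l (fun w => A s w * B s w) by exact: bdmM.
rewrite (@a1 l i (fun w => A s w * B s w ^+ 2))//; last exact: bdmM.
rewrite (@a1 l k (fun w => B s w * A s w ^+ 2))//; last exact: bdmM.
rewrite (@a22 l i (fun w => B s w ^+ 2))// (@a22 l k (fun w => A s w ^+ 2))//.
rewrite (@a3 l i k k (A s))// (@a3 l i i k (B s))// (@a2 l i k _ il kl fAB).
rewrite A2// B2//.
rewrite (_ : Ex P (fun w => g i k w * (A s w * B s w)) = c * (size s)%:R / D); last first.
  by rewrite -ABg//; apply: eq_Ex => w; rewrite mulrC.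
have r4 : Ex P (fun w => a l i w ^+ 2 * a l k w ^+ 2) <= k4.
  apply: (@le_trans _ _ (Ex P (fun w => 2^-1 * a l i w ^+ 4 + 2^-1 * a l k w ^+ 4))).
    apply: Ex_le; [bdm|bdm|move=> w].
    have := sqr_ge0 (a l i w ^+ 2 - a l k w ^+ 2).
    by rewrite sqrrB -!exprM mulr2n; lra.
  rewrite ExD; [|bdm|bdm]; rewrite !ExZ; [|bdm|bdm].
  by have := @a4 l i il; have := @a4 l k kl; lra.
have := IH us is_ ks; rewrite -[(size s).+1]addn1 natrD -!(mulrA _ _ D^-1).
have m0 : 0 <= (size s)%:R :> R by [].
have Di : 0 <= D^-1 by rewrite invr_ge0 ltW.
have cD : 0 <= c * c * D^-1 by rewrite mulr_ge0// mulr_ge0.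
move: r4; move: (size s)%:R m0 D^-1 Di cD => m m0 Di Di0 cD.
by move: (Ex _ _) (Ex _ _) => e1 e2; rewrite !expr2; nra.
Qed.

End pair.

Definition leave_out i w := \sum_(j < n | j != i) a i j w.
Definition half_sum w := 2^-1 * \sum_(i < n) leave_out i w.
Local Notation Ti := leave_out.
Local Notation S := half_sum.
Let V w := 2^-1 * \sum_(i < n) Ti i w ^+ 2.

Let Tb i : bdm (Ti i). Proof. exact: bdm_sum. Qed.

Let TE i w : Ti i w = Rs (enum (predC1 i)) i w.
Proof. by rewrite /Ti /Rs big_enum. Qed.

Let size_predC1 (i : 'I_n) : size (enum (predC1 i)) = n.-1.
Proof. by rewrite -cardE cardC1 card_ord. Qed.

Let predn_nat : n.-1%:R = n%:R - 1 :> R.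
Proof. by rewrite -[in RHS](prednK n0) -addn1 natrD addrK. Qed.

Lemma leave_out_moment2 i : Ex P (fun w => Ti i w ^+ 2) = c * (n%:R - 1).
Proof.
under eq_Ex do rewrite TE.
by rewrite E2 ?enum_uniq ?mem_enum ?inE ?eqxx// size_predC1 predn_nat.
Qed.

Lemma leave_out_moment4 i : Ex P (fun w => Ti i w ^+ 4) <= 48 / n%:R ^+ 2.
Proof.
under eq_Ex do rewrite TE.
apply: (le_trans (E4 _ _)); rewrite ?enum_uniq ?mem_enum ?inE ?eqxx//.
rewrite size_predC1; have mn : n.-1%:R <= n%:R :> R by rewrite ler_nat leq_pred.
apply: (@le_trans _ _ (k4 * n%:R + 3 * c ^+ 2 * n%:R ^+ 2)).
  by apply: lerD; apply: ler_wpM2l; rewrite ?mulr_ge0 ?sqr_ge0// lerXn2r ?nnegrE.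
(* The bound is 36/n^3 + 12/n^2, and 48 = 36 + 12 because n >= 1. *)
have n1 : n%:R^-1 <= 1 :> R by rewrite invf_le1// ler1n.
have -> : k4 * n%:R + 3 * c ^+ 2 * n%:R ^+ 2 = (36 * n%:R^-1 + 12) * n%:R ^- 2.
  by rewrite /k4 /c; field.
by apply: ler_wpM2r; [rewrite invr_ge0 sqr_ge0|lra].
Qed.

Lemma leave_out_moment22 i k : i != k ->
  Ex P (fun w => Ti i w ^+ 2 * Ti k w ^+ 2) <=
  (36 / n%:R + 4 + 8 / D) / n%:R ^+ 2.
Proof.
move=> ik; pose s := enum [pred j | (j != i) && (j != k)].
have us : uniq s by rewrite enum_uniq.
have is_ : i \notin s by rewrite mem_enum !inE eqxx.
have ks : k \notin s by rewrite mem_enum !inE eqxx andbF.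
have TiE w : Ti i w = a i k w + Rs s i w.
  rewrite /Ti (bigD1 k)/=; last by rewrite eq_sym.
  by rewrite /Rs /s big_enum/=.
have TkE w : Ti k w = a i k w + Rs s k w.
  rewrite /Ti (bigD1 i)//= aC; congr (_ + _).
  by rewrite /Rs /s big_enum/=; apply: eq_bigl => j; rewrite andbC.
under eq_Ex do rewrite TiE TkE.
apply: (le_trans (pair_moment22 ik us is_ ks)).
(* Only m + 1 <= n is used of the length m of [s]; it replaces m and m + 1 by n in each summand. *)
have sn : (size s).+1%:R <= n%:R :> R.
  rewrite ler_nat -[(size s).+1]/(size (i :: s)) -[X in (_ <= X)%N](card_ord n).
  rewrite cardE; apply: uniq_leq_size; first by rewrite /= is_.
  by move=> j _; rewrite mem_enum.
rewrite -addn1 natrD in sn; move: sn; have : 0 <= (size s)%:R :> R by [].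
move: (size s)%:R => m m0 mn.
apply: (@le_trans _ _ (k4 * n%:R + c ^+ 2 * n%:R * n%:R + 2 * c ^+ 2 * n%:R ^+ 2 / D)).
  have c20 : 0 <= c ^+ 2 by rewrite sqr_ge0.
  apply: lerD; first apply: lerD.
  - exact: ler_wpM2l.
  - rewrite -!(mulrA (c ^+ 2)); apply: ler_wpM2l => //; apply: ler_pM => //.
      by rewrite addr_ge0.
    by rewrite (le_trans _ mn)// lerDl.
  - apply: ler_wpM2r; first by rewrite invr_ge0 ltW.
    apply: ler_wpM2l; first by rewrite mulr_ge0.
    by rewrite lerXn2r ?nnegrE// (le_trans _ mn)// lerDl.
rewrite le_eqVlt; apply/orP; left; apply/eqP; rewrite /k4 /c; field.
by rewrite nR0 gt_eqF.
Qed.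

Let Vb : bdm V.
Proof. by apply: bdmM; [exact: bdm_cst|apply: bdm_sum => i _; exact: bdmX]. Qed.

Let EV : Ex P V = 1 - n%:R^-1.
Proof.
rewrite /V ExZ; last by apply: bdm_sum => i _; exact: bdmX.
rewrite Ex_sum; last by move=> i _; exact: bdmX.
under eq_bigr do rewrite leave_out_moment2.
rewrite sumr_const card_ord -(mulr_natr (c * _)) /c.
by field.
Qed.

(** The n^2 pairs give a quarter of 36/n + 4 + 8/D, that is 9/n + 1 + 2/D, and the diagonal adds a
    quarter of 48/n; whence 21 = 9 + 12. *)
Let EV2 : Ex P (fun w => V w ^+ 2) <= 1 + 2 / D + 21 / n%:R.
Proof.
pose b := (36 / n%:R + 4 + 8 / D) / n%:R ^+ 2.
have b0 : 0 <= b.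
  rewrite divr_ge0 ?sqr_ge0// addr_ge0 ?addr_ge0 ?divr_ge0 ?ler0n// ?ltW//.
have bT i k : bdm (fun w => Ti i w ^+ 2 * Ti k w ^+ 2).
  by apply: bdmM; exact: bdmX.
have -> : Ex P (fun w => V w ^+ 2) = 4^-1 * \sum_(i < n) \sum_(k < n)
    Ex P (fun w => Ti i w ^+ 2 * Ti k w ^+ 2).
  transitivity (4^-1 * Ex P (fun w => \sum_(i < n) \sum_(k < n)
      (Ti i w ^+ 2 * Ti k w ^+ 2))).
    rewrite -ExZ; last by apply: bdm_sum => i _; exact: bdm_sum.
    apply: eq_Ex => w; rewrite /V exprMn expr2 -[in RHS](eq_bigr _ (fun i _ => mulr_sumr _ _ _ _)).
    by rewrite -mulr_suml -expr2; field.
  rewrite Ex_sum; last by move=> i _; exact: bdm_sum.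
  by congr (_ * _); apply: eq_bigr => i _; rewrite Ex_sum.
apply: (@le_trans _ _ (4^-1 * \sum_(i < n) \sum_(k < n)
    (b + (if k == i then 48 / n%:R ^+ 2 else 0)))).
  apply: ler_wpM2l => //; apply: ler_sum => i _; apply: ler_sum => k _.
  case: eqVneq => [->|ki]; last by rewrite addr0 leave_out_moment22// eq_sym.
  apply: le_trans (_ : 48 / n%:R ^+ 2 <= _); last by rewrite lerDr.
  by apply: le_trans (leave_out_moment4 i); under eq_Ex do rewrite -exprD.
under eq_bigr => i _.
  rewrite big_split/= -big_mkcond/= big_pred1_eq sumr_const card_ord; over.
rewrite sumr_const card_ord -(mulr_natr (_ + _)) -(mulr_natr b) /b le_eqVlt.
by apply/orP; left; apply/eqP; field; rewrite nR0 gt_eqF.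
Qed.

(** The mean of [V] is 1 - 1/n rather than 1, which raises 21 to 23. *)
Let EV1 : Ex P (fun w => (V w - 1) ^+ 2) <= 2 / D + 23 / n%:R.
Proof.
have bV := Vb.
have -> : Ex P (fun w => (V w - 1) ^+ 2) =
    Ex P (fun w => V w ^+ 2) + (-2) * Ex P V + Ex P (fun=> 1).
  by Ex_linear.
by rewrite EV Ex_cst; have := EV2; lra.
Qed.

Lemma half_sum_bdm : bdm S.
Proof. by apply: bdmM; [exact: bdm_cst|apply: bdm_sum]. Qed.

(** By symmetry, row i and column i contribute half of [Ti i] each, so subtracting the full row sum
    erases the index [i] altogether. *)
Lemma half_sum_leave_out i w : S w - Ti i w =
  2^-1 * \sum_(k < n | k != i) \sum_(j < n | (j != k) && (j != i)) a k j w.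
Proof.
have -> : \sum_(k < n | k != i) \sum_(j < n | (j != k) && (j != i)) a k j w =
    \sum_(k < n | k != i) (Ti k w - a i k w).
  apply: eq_bigr => k ki; rewrite /Ti [in RHS](bigD1 i)/=; last by rewrite eq_sym.
  by rewrite (aC i k) addrAC subrr add0r.
rewrite /S (bigD1 i)//= sumrB -/(Ti i w); by field.
Qed.

Let ST_free i : fr i (fun w => S w - Ti i w).
Proof.
apply: (@eq_bdm _ _ (g_sigma_algebraType (F i)) (fun w => 2^-1 *
  \sum_(k < n | k != i) \sum_(j < n | (j != k) && (j != i)) a k j w)).
  by move=> w; rewrite half_sum_leave_out.
apply: bdmM; first exact: bdm_cst.
by apply: bdm_sum => k ki; apply: bdm_sum => j /andP[jk ji]; exact: af.
Qed.

Let E_TG i G : fr i G -> Ex P (fun w => Ti i w * G w) = 0.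
Proof.
move=> fG; have bG := fr_bdm fG.
rewrite (@eq_Ex _ _ _ _ _ (fun w => \sum_(j < n | j != i) (a i j w * G w))); last first.
  by move=> w; rewrite mulr_suml.
rewrite Ex_sum; last by move=> j _; exact: bdmM.
by rewrite big1// => j ji; exact: a1.
Qed.

(** S^2 is [V] plus half the sum of T_i (S - T_i); the latter products have mean 0, and [V] has mean
    1 - 1/n. *)
Lemma half_sum_moment2 : Ex P (fun w => S w ^+ 2) <= 1.
Proof.
have bS := half_sum_bdm.
have bT i : bdm (fun w => Ti i w * (S w - Ti i w)).
  by apply: bdmM => //; exact: fr_bdm (ST_free i).
have -> : Ex P (fun w => S w ^+ 2) = Ex P V +
    2^-1 * Ex P (fun w => \sum_(i < n) (Ti i w * (S w - Ti i w))).
  have bV := Vb; have bs : bdm (fun w => \sum_(i < n) (Ti i w * (S w - Ti i w))).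
    exact: bdm_sum.
  rewrite -ExZ// -ExD//; last by bdm.
  apply: eq_Ex => w; rewrite /V -mulrDr -big_split/= [LHS]expr2 {1}/S -mulrA.
  rewrite mulr_suml; congr (_ * _); apply: eq_bigr => i _; ring.
rewrite Ex_sum// big1; last by move=> i _; exact: E_TG.
by rewrite EV mulr0 addr0 gerBl invr_ge0 ltW.
Qed.

(** The free parameter [e] stems from a weighted arithmetic-geometric inequality used in place of
    Cauchy-Schwarz: it trades |T_i|^3 for T_i^2 and T_i^4, and |V - 1| for its square, with no
    square roots. *)
Lemma half_sum_stein (f f' : R -> R) (B L e : R) :
  measurable_fun setT f -> measurable_fun setT f' ->
  (exists M : R, forall x, `|f x| <= M) -> (forall x, `|f' x| <= B) ->
  0 <= L -> (forall s t, `|f s - f (s - t) - t * f' s| <= L * t ^+ 2) -> 0 < e ->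
  `|Ex P (fun w => S w * f (S w) - f' (S w))| <=
  L * (e + 12 / n%:R / e) + B * (e + (2 / D + 23 / n%:R) / e).
Proof.
move=> mf mf' bf f'B L0 fL e0.
have B0 : 0 <= B by apply: le_trans (f'B 0).
have bS := half_sum_bdm; have bV := Vb.
have mS : measurable_fun setT S by case: bS.
have bfS : bdm (fun w => f (S w)) by exact: bdm_comp.
have bf'S : bdm (fun w => f' (S w)) by apply: bdm_comp => //; exists B.
have fST i : fr i (fun w => f (S w - Ti i w)).
  have [m _] := ST_free i.
  exact: (@bdm_comp _ _ (g_sigma_algebraType (F i)) f (fun w => S w - Ti i w)).
have bfST i : bdm (fun w => f (S w - Ti i w)) by exact: fr_bdm (fST i).
(* [Q] collects the Taylor remainders and the fluctuation of [V]. The rest of S f(S) - f'(S) is half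
   of [Z], which has mean 0 because S - T_i is free of the index [i]. *)
pose Q w := 2^-1 * \sum_(i < n) (Ti i w * (f (S w) - f (S w - Ti i w) - Ti i w * f' (S w)))
  + f' (S w) * (V w - 1).
pose Z w := \sum_(i < n) (Ti i w * f (S w - Ti i w)).
have bZ : bdm Z by apply: bdm_sum => i _; exact: bdmM.
have bQ : bdm Q.
  rewrite /Q; apply: bdmD; last by bdm.
  apply: bdmM; first exact: bdm_cst.
  by apply: bdm_sum => i _; have bT := Tb i; have bf1 := bfST i; bdm.
have -> : Ex P (fun w => S w * f (S w) - f' (S w)) = Ex P Q + 2^-1 * Ex P Z.
  rewrite -ExZ// -ExD//; last by bdm.
  apply: eq_Ex => w; rewrite /Q /Z addrAC -mulrDr -big_split/=.
  rewrite (eq_bigr (fun i => Ti i w * f (S w) - Ti i w ^+ 2 * f' (S w))); last first.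
    by move=> i _; ring.
  rewrite sumrB -!mulr_suml /V {1}/S; ring.
have -> : Ex P Z = 0.
  rewrite Ex_sum; last by move=> i _; exact: bdmM.
  by rewrite big1// => i _; exact: E_TG.
rewrite mulr0 addr0; apply: (le_trans (Ex_norm P bQ)).
pose b w := \sum_(i < n) (4^-1 * L * e * Ti i w ^+ 2 + 4^-1 * L / e * Ti i w ^+ 4)
  + (2^-1 * B * e + 2^-1 * B / e * (V w - 1) ^+ 2).
have amgm (x y : R) : 0 <= x -> x * y <= 2^-1 * e * x + 2^-1 * (x * y ^+ 2) / e.
  move=> x0; rewrite -(ler_pM2r e0) mulrDl divfK ?gt_eqF//.
  by have := mulr_ge0 x0 (sqr_ge0 (y - e)); rewrite sqrrB; lra.
have bTi i : bdm (fun w => 4^-1 * L * e * Ti i w ^+ 2 + 4^-1 * L / e * Ti i w ^+ 4).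
  by have bT := Tb i; bdm.
apply: (@le_trans _ _ (Ex P b)).
  apply: Ex_le.
  - exact: bdm_norm.
  - by apply: bdmD; [exact: bdm_sum|bdm].
  move=> w; apply: (le_trans (ler_normD _ _)); apply: lerD.
    rewrite normrM ger0_norm//.
    apply: (le_trans (ler_wpM2l _ (ler_norm_sum _ _ _)))=> //.
    rewrite mulr_sumr; apply: ler_sum => i _; rewrite normrM.
    have h := ler_wpM2l (normr_ge0 (Ti i w)) (fL (S w) (Ti i w)).
    apply: le_trans (ler_wpM2l _ h) _ => //.
    have h3 := amgm (Ti i w ^+ 2) `|Ti i w| (sqr_ge0 _).
    rewrite real_normK ?num_real// in h3.
    have := ler_wpM2l L0 h3.
    rewrite (_ : Ti i w ^+ 4 = Ti i w ^+ 2 * Ti i w ^+ 2); last by rewrite -exprD.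
    lra.
  rewrite normrM; apply: (le_trans (ler_wpM2r (normr_ge0 _) (f'B _))).
  have := ler_wpM2l B0 (amgm 1 `|V w - 1| ler01).
  rewrite mul1r real_normK ?num_real//; lra.
rewrite /b ExD; [|exact: bdm_sum|bdm].
rewrite Ex_sum// ExD; [|bdm|bdm]; rewrite Ex_cst ExZ; last by bdm.
have hs : \sum_(i < n) Ex P (fun w => 4^-1 * L * e * Ti i w ^+ 2 + 4^-1 * L / e * Ti i w ^+ 4)
    <= L * (e + 12 / n%:R / e).
  apply: (@le_trans _ _ (\sum_(i < n) (4^-1 * L * e * (2 / n%:R) +
      4^-1 * L / e * (48 / n%:R ^+ 2)))).
    apply: ler_sum => i _; have bT := Tb i; rewrite ExD; [|bdm|bdm].
    rewrite !ExZ; [|bdm|bdm]; rewrite leave_out_moment2; apply: lerD.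
      apply: ler_wpM2l; first by rewrite !mulr_ge0// ltW.
      rewrite (_ : c * (n%:R - 1) = 2 / n%:R - c); last by rewrite /c; field.
      by rewrite gerBl.
    apply: ler_wpM2l; last exact: leave_out_moment4.
    by rewrite !mulr_ge0// invr_ge0 ltW.
  rewrite sumr_const card_ord -[leLHS]mulr_natr.
  have -> : (4^-1 * L * e * (2 / n%:R) + 4^-1 * L / e * (48 / n%:R ^+ 2)) * n%:R =
      L * (2^-1 * e + 12 / n%:R / e) by field; rewrite nR0 gt_eqF.
  by apply: ler_wpM2l => //; rewrite lerD2r; lra.
apply: lerD => //.
have hv := ler_wpM2l (_ : 0 <= 2^-1 * B / e) EV1.
apply: (@le_trans _ _ (2^-1 * B * e + 2^-1 * B / e * (2 / D + 23 / n%:R))).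
  by rewrite lerD2l; apply: hv; rewrite !mulr_ge0// invr_ge0 ltW.
have h0 : 0 <= (2 / D + 23 / n%:R) / e.
  by rewrite divr_ge0 ?ltW// addr_gt0// divr_gt0.
have -> : 2^-1 * B * e + 2^-1 * B / e * (2 / D + 23 / n%:R) =
   2^-1 * (B * (e + (2 / D + 23 / n%:R) / e)) by ring.
have : 0 <= B * (e + (2 / D + 23 / n%:R) / e) by rewrite mulr_ge0// addr_ge0// ltW.
by lra.
Qed.

End kernel_sum.

(** * Stein's equation *)

Section real_calculus.
Context {R : realType}.

Lemma lipschitz_continuous (k : R -> R) (L : R) :
  (forall x y, `|k x - k y| <= L * `|x - y|) -> continuous k.
Proof.
move=> kL x; apply/cvgrPdist_le => e e0.
have L1 : 0 < `|L| + 1 by rewrite ltr_wpDl.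
apply/nbhs_ballP; exists (e / (`|L| + 1)); first exact: divr_gt0.
move=> y; rewrite /ball/= => xy; apply: (le_trans (kL x y)).
apply: (@le_trans _ _ ((`|L| + 1) * (e / (`|L| + 1)))); last by rewrite mulrC divfK// gt_eqF.
apply: (@le_trans _ _ (`|L| * `|x - y|)); first by rewrite ler_wpM2r// ler_norm.
by apply: ler_pM => //; [rewrite lerDl|exact: ltW].
Qed.

Lemma MVT_step (f df : R -> R) : (forall x : R, is_derive x 1 f (df x)) ->
  forall s t, exists2 z, `|z - s| <= `|t| & f s - f (s - t) = t * df z.
Proof.
move=> dfP; have cf : continuous f.
  by move=> x; apply: differentiable_continuous; apply/derivable1_diffP; case: (dfP x).
have cw (A : set R) : {within A, continuous f} by exact: continuous_subspaceT.
move=> s t; have [t0|t0] := leP 0 t.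
  have st : s - t <= s by rewrite gerBl.
  have [z + E] := MVT_segment st (fun x _ => dfP x) (cw _).
  rewrite in_itv/= => /andP[z1 z2]; exists z; last by rewrite E opprB addrC subrK mulrC.
  by rewrite distrC ger0_norm ?subr_ge0// ger0_norm//; lra.
have st : s <= s - t by rewrite lerBrDr gerDl ltW.
have [z + E] := MVT_segment st (fun x _ => dfP x) (cw _).
rewrite in_itv/= => /andP[z1 z2]; exists z.
  by rewrite ger0_norm ?subr_ge0// ltr0_norm//; lra.
by rewrite -opprB E; ring.
Qed.

Lemma continuous_compact_supp_bounded (f : R -> R) (M : R) : 0 <= M ->
  continuous f -> (forall x, M <= `|x| -> f x = 0) ->
  exists2 B : R, 0 <= B & forall x, `|f x| <= B.
Proof.
move=> M0 cf f0; have cn : continuous (fun x => `|f x|).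
  by move=> x; apply: (cvg_norm (cf x)).
have MM : - M <= M by lra.
have [z _ zM] := EVT_max MM (continuous_subspaceT cn).
exists `|f z| => // x; have [Mx|xM] := leP M `|x|.
  by rewrite f0// normr0.
by apply: zM; rewrite in_itv/= -ler_norml ltW.
Qed.

End real_calculus.

Section stein_equation.
Context {R : realType}.
Local Notation mu := (@lebesgue_measure R).
Local Notation phi := (@normal_pdf R 0 1).

Definition normal_Ex (u : R -> R) : R := \int[mu]_x (u x * phi x).

Let oner_neq0' : (1 : R) != 0. Proof. exact: oner_neq0. Qed.

Let phiE x : phi x = normal_peak 1 * expR (- (x ^+ 2 / 2)).
Proof.
rewrite normal_pdfE// /normal_fun subr0 expr1n; congr (_ * expR _).
by rewrite mulNr.
Qed.

Lemma normal_integrable (u : R -> R) : measurable_fun setT u ->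
  (exists K : R, forall x, `|u x| <= K) ->
  mu.-integrable setT (EFin \o (fun x => u x * phi x)).
Proof.
move=> m_u [K uK]; have K0 : 0 <= K by exact: le_trans (uK 0).
have iK : mu.-integrable setT (EFin \o (fun x => K * phi x)).
  have := integrableZl measurableT K (integrable_normal_pdf (0 : R) 1).
  by apply: eq_integrable => // x _ /=; rewrite EFinM.
apply: le_integrable iK => //.
  apply/measurable_EFinP; apply: measurable_funM => //.
  exact: measurable_normal_pdf.
move=> x _ /=; rewrite lee_fin !normrM (ger0_norm K0).
by apply: ler_wpM2r.
Qed.

Section solution.
Variables (k : R -> R) (M Lk : R).
Hypothesis M0 : 0 <= M.
Hypothesis kL : forall x y, `|k x - k y| <= Lk * `|x - y|.
Hypothesis kM : forall x, M <= `|x| -> k x = 0.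
Hypothesis k0 : normal_Ex k = 0.

Let ck : continuous k := lipschitz_continuous kL.
Let mk : measurable_fun setT k. Proof. exact: continuous_measurable_fun. Qed.
Let h x := k x * phi x.
Let F y := \int[mu]_(t in `]-oo, y]) h t.

Let kB : exists2 B : R, 0 <= B & forall x, `|k x| <= B.
Proof. exact: continuous_compact_supp_bounded M0 ck kM. Qed.

Let ih : mu.-integrable setT (EFin \o h).
Proof. by apply: normal_integrable => //; case: kB => B _ ?; exists B. Qed.

Let F'E (x : R) : is_derive x 1 F (h x).
Proof.
have ch : {for x, continuous h}.
  apply: cvgM; first exact: ck.
  exact: continuous_normal_pdf.
have iu : mu.-integrable [set` `]-oo, (x + 1)]] (EFin \o h).
  by apply: integrableS ih.
have [|dF F'] := continuous_FTC1 (ltr_pwDr ltr01 (lexx x)) iu _ ch.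
  exact: ltNyr.
by apply: DeriveDef => //; rewrite -derive1E.
Qed.

(** Left of -M the integrand vanishes; right of M the integral has reached the whole Gaussian mean
    of [k], which is 0 by [k0]. *)
Let F0 y : M <= `|y| -> F y = 0.
Proof.
move=> My; have [y0|y0] := leP 0 y.
  rewrite -[RHS]k0 /F Rintegral_mkcond /normal_Ex; apply: eq_Rintegral => t _.
  rewrite patchE; case: ifPn => //; rewrite notin_setE/= in_itv/= => /negP.
  rewrite -ltNge => yt; rewrite kM ?mul0r//.
  by rewrite (le_trans My)// !ger0_norm// ltW// (le_lt_trans y0 yt).
rewrite /F (@eq_Rintegral _ _ _ _ _ (fun=> 0)); last first.
  move=> t; rewrite inE/= in_itv/= => ty; rewrite /h kM ?mul0r//.
  by rewrite (le_trans My)// !ltr0_norm ?lerN2// (le_lt_trans ty).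
by rewrite Rintegral_cst// mul0r.
Qed.

(** The reciprocal of the Gaussian density, an integrating factor for f'(x) - x f(x). *)
Let G (x : R) := (normal_peak 1)^-1 * expR (x ^+ 2 / 2).

Let G'E (x : R) : is_derive x 1 G (x * G x).
Proof.
have d2 : is_derive x 1 (fun y : R => y ^+ 2 / 2) x.
  rewrite (_ : (fun y : R => y ^+ 2 / 2) = id ^+ 2 * cst 2^-1); last first.
    by apply/funext => y; rewrite !fctE.
  apply: is_derive_eq (is_deriveM (is_deriveX 2 (is_derive_id x (1 : R)))
    (is_derive_cst (2^-1 : R) x 1)) _.
  by rewrite scaler0 add0r /GRing.scale/=; field.
have d3 := @is_derive1_comp R expR (fun y => y ^+ 2 / 2) x _ _ (is_derive_expR _) d2.
rewrite (_ : G = (normal_peak 1)^-1 *: (expR \o (fun y => y ^+ 2 / 2))); last first.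
  by apply/funext => y; rewrite !fctE.
apply: is_derive_eq (is_deriveZ _ d3) _.
rewrite -[RHS]/(x * ((normal_peak 1)^-1 * expR (x ^+ 2 / 2))) /GRing.scale/=.
by ring.
Qed.

Let f x := F x * G x.
Let f' x := x * f x + k x.

Let df (x : R) : is_derive x 1 f (f' x).
Proof.
apply: is_derive_eq (is_deriveM (F'E x) (G'E x)) _.
rewrite /GRing.scale/= /f' /f /h phiE /G expRN.
have e0 : expR (x ^+ 2 / 2) != 0 by rewrite gt_eqF// expR_gt0.
have p0 : normal_peak 1 != 0 :> R by rewrite gt_eqF// normal_peak_gt0.
by field; rewrite p0 e0.
Qed.

Let f0 x : M <= `|x| -> f x = 0.
Proof. by move=> Mx; rewrite /f F0// mul0r. Qed.

Let f'0 x : M <= `|x| -> f' x = 0.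
Proof. by move=> Mx; rewrite /f' f0// kM// mulr0 addr0. Qed.

Let cf : continuous f.
Proof.
by move=> x; apply: differentiable_continuous; apply/derivable1_diffP; case: (df x).
Qed.

Let cf' : continuous f'.
Proof.
move=> x; apply: cvgD; last exact: ck.
by apply: cvgM; [exact: cvg_id|exact: cf].
Qed.

(* [f] is the usual solution of Stein's equation f'(x) - x f(x) = k(x); as [k]
   has compact support and Gaussian mean 0, so has [f] compact support. *)
Lemma stein_solution : exists (f f' : R -> R) (B L : R),
  [/\ measurable_fun setT f, measurable_fun setT f',
    (exists M : R, forall x, `|f x| <= M), forall x, `|f' x| <= B &
    [/\ 0 <= L, forall s t, `|f s - f (s - t) - t * f' s| <= L * t ^+ 2
     & forall x, x * f x - f' x = - k x]].
Proof.
have [B0 B00 fB0] := continuous_compact_supp_bounded M0 cf f0.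
have [B1 B10 fB1] := continuous_compact_supp_bounded M0 cf' f'0.
(* As [k] is only Lipschitz, [f'] need not be differentiable. Its Lipschitz constant is assembled
   from a derivative bound for x f(x), nonzero only where |x| < M, and from [Lk]; it serves as
   [L]. *)
have d2 (x : R) : is_derive x 1 (fun y => y * f y) (f x + x * f' x).
  apply: is_derive_eq (is_deriveM (is_derive_id x 1) (df x)) _.
  by rewrite /GRing.scale/= mulr1 addrC.
have d2B x : `|f x + x * f' x| <= B0 + M * B1.
  have [Mx|xM] := leP M `|x|.
    by rewrite f0// f'0// mulr0 addr0 normr0 addr_ge0// mulr_ge0.
  by rewrite (le_trans (ler_normD _ _))// lerD// normrM ler_pM// ltW.
have Lk0 : 0 <= Lk by have := kL 1 0; rewrite subr0 normr1 mulr1; exact: le_trans.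
exists f, f', B1, (B0 + M * B1 + Lk); split => //.
- exact: continuous_measurable_fun.
- exact: continuous_measurable_fun.
- by exists B0.
split.
- by rewrite !addr_ge0// mulr_ge0.
- move=> s t; have [z zs ->] := MVT_step df s t.
  rewrite -mulrBr normrM -[X in _ <= _ * X]real_normK ?num_real// expr2 mulrCA.
  apply: ler_wpM2l => //; rewrite /f' opprD addrACA.
  apply: (le_trans (ler_normD _ _)); rewrite mulrDl; apply: lerD; last first.
    by apply: (le_trans (kL _ _)); apply: ler_wpM2l.
  have [y _ E] := MVT_step d2 z (z - s).
  rewrite subKr in E; rewrite E normrM mulrC.
  by apply: ler_pM.
- by move=> x; rewrite /f' opprD addrA subrr add0r.
Qed.

End solution.
End stein_equation.

(** * Convergence of distribution functions *)

Section normal_expectation.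
Context {R : realType}.
Local Notation mu := (@lebesgue_measure R).
Local Notation phi := (@normal_pdf R 0 1).
Local Notation N := (@normal_prob R 0 1).
Implicit Types u v : R -> R.

Let phi_int u : bdm u -> mu.-integrable setT (EFin \o (fun x => u x * phi x)).
Proof. by move=> [m_u b_u]; exact: normal_integrable. Qed.

Lemma normal_ExD u v : bdm u -> bdm v ->
  normal_Ex (fun x => u x + v x) = normal_Ex u + normal_Ex v.
Proof.
move=> bu bv; rewrite /normal_Ex -RintegralD//; [|exact: phi_int..].
by apply: eq_Rintegral => x _; rewrite mulrDl.
Qed.

Lemma normal_ExZ c u : bdm u -> normal_Ex (fun x => c * u x) = c * normal_Ex u.
Proof.
move=> bu; rewrite /normal_Ex -RintegralZl//; last exact: phi_int.
by apply: eq_Rintegral => x _; rewrite mulrA.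
Qed.

Lemma normal_Ex_le u v : bdm u -> bdm v -> (forall x, u x <= v x) ->
  normal_Ex u <= normal_Ex v.
Proof.
move=> bu bv uv; apply: le_Rintegral => //; [exact: phi_int..|].
by move=> x _; rewrite ler_wpM2r// normal_pdf_ge0.
Qed.

Lemma bdm_indic (d : measure_display) (T : measurableType d) (A : set T) :
  measurable A -> bdm (\1_A : T -> R).
Proof.
move=> mA; split; first exact: measurable_indic.
by exists 1 => t; rewrite indicE; case: (_ \in _); rewrite ?normr1 ?normr0.
Qed.

Lemma normal_Ex_indic (A : set R) : measurable A -> normal_Ex \1_A = fine (N A).
Proof.
move=> mA; rewrite /normal_Ex /normal_prob -/(Rintegral mu A phi) [RHS]Rintegral_mkcond.
apply: eq_Rintegral => x _; rewrite patchE indicE.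
by case: ifPn => _; rewrite ?mul1r ?mul0r.
Qed.

Lemma normal_Ex1 : normal_Ex (fun=> 1 : R) = 1.
Proof.
transitivity (normal_Ex \1_[set: R]).
  by congr normal_Ex; apply/funext => x; rewrite indicT.
by rewrite normal_Ex_indic// probability_setT.
Qed.

Lemma measurable_gt_norm (c : R) : measurable [set x : R | c < `|x|].
Proof.
rewrite (_ : [set _ | _] = (fun x : R => `|x|) @^-1` `]c, +oo[%classic).
  rewrite -[X in measurable X]setTI; apply: continuous_measurable_fun => //.
  apply: (@lipschitz_continuous _ _ 1) => x y.
  by rewrite mul1r; exact: ler_dist_dist.
by apply/seteqP; split => x /=; rewrite in_itv/= andbT.
Qed.

Definition normal_cdf (x : R) : R := fine (N `]-oo, x]).

(** The derivative is the density, which is bounded by its peak. *)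
Lemma normal_cdf_lipschitz x y : `|normal_cdf x - normal_cdf y| <= normal_peak 1 * `|x - y|.
Proof.
have d (z : R) : is_derive z 1 normal_cdf (phi z).
  have cp : {for z, continuous phi} by exact: continuous_normal_pdf.
  have iu : mu.-integrable [set` `]-oo, (z + 1)]] (EFin \o phi).
    by apply: integrableS (integrable_normal_pdf _ _).
  have [|dF F'] := continuous_FTC1 (ltr_pwDr ltr01 (lexx z)) iu _ cp.
    exact: ltNyr.
  by apply: DeriveDef => //; rewrite -derive1E.
have [z _] := MVT_step d x (x - y); rewrite subKr => ->.
rewrite normrM mulrC ler_wpM2r// ger0_norm ?normal_pdf_ge0//.
exact: normal_pdf_ub.
Qed.

Lemma normal_tail (e : R) : 0 < e ->
  \forall K \near \oo, fine (N [set x | K%:R < `|x|]) <= e.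
Proof.
move=> e0; pose A (K : nat) : set R := [set x | K%:R < `|x|].
have mA K : measurable (A K) by exact: measurable_gt_norm.
have cA : N (A K) @[K --> \oo] --> N (\bigcap_K A K).
  apply: nonincreasing_cvg_mu => //.
  - by rewrite (le_lt_trans (probability_le1 N (mA 0%N)))// ltry.
  - exact: bigcapT_measurable.
  - move=> i j ij; apply/subsetPset => x; rewrite /A /=; apply: le_lt_trans.
    by rewrite ler_nat.
have A0 : \bigcap_K A K = set0.
  apply/seteqP; split => // x /(_ (Num.truncn `|x|).+1 I).
  by rewrite /A/= ltNge ltW// truncnS_gt.
rewrite A0 measure0 in cA.
have /fine_cvgP[_ /cvgrPdist_le/(_ e e0)] := cA.
apply: filterS => K; rewrite /= sub0r normrN => h.
exact: le_trans (ler_norm _) h.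
Qed.

End normal_expectation.

Section trapezoid.
Context {R : realType}.

(** For l <= r this is 1 on [l, r], 0 outside [l - e, r + e] and affine in between. With [l] far to
    the left it replaces the indicator of a half-line while keeping compact support. *)
Definition trapezoid (l r e x : R) : R :=
  Num.max 0 (Num.min 1 (Num.min (1 + (x - l) / e) (1 + (r - x) / e))).

Lemma trapezoid_ge0 (l r e x : R) : 0 <= trapezoid l r e x.
Proof. by rewrite /trapezoid le_max lexx. Qed.

Lemma trapezoid_le1 (l r e x : R) : trapezoid l r e x <= 1.
Proof. by rewrite /trapezoid ge_max ler01 ge_min lexx. Qed.

Lemma trapezoid1 (l r e x : R) : 0 < e -> l <= x <= r -> trapezoid l r e x = 1.
Proof.
move=> e0 /andP[lx xr]; apply/eqP; rewrite eq_le trapezoid_le1/= /trapezoid le_max.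
apply/orP; right; rewrite !le_min lexx/= !lerDl.
by rewrite !divr_ge0 ?subr_ge0// ltW.
Qed.

Lemma trapezoid0r (l r e x : R) : 0 < e -> r + e <= x -> trapezoid l r e x = 0.
Proof.
move=> e0 rx; apply/eqP; rewrite eq_le trapezoid_ge0 andbT /trapezoid ge_max lexx/=.
rewrite !ge_min; apply/orP; right; apply/orP; right.
rewrite -(ler_pM2r e0) mul0r mulrDl divfK ?gt_eqF// mul1r; lra.
Qed.

Lemma trapezoid0l (l r e x : R) : 0 < e -> x <= l - e -> trapezoid l r e x = 0.
Proof.
move=> e0 rx; apply/eqP; rewrite eq_le trapezoid_ge0 andbT /trapezoid ge_max lexx/=.
rewrite !ge_min; apply/orP; right; apply/orP; left.
rewrite -(ler_pM2r e0) mul0r mulrDl divfK ?gt_eqF// mul1r; lra.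
Qed.

Lemma trapezoid_lipschitz (l r e : R) : 0 < e -> forall x y : R,
  `|trapezoid l r e x - trapezoid l r e y| <= e^-1 * `|x - y|.
Proof.
move=> e0.
have max_lip (a b c d C : R) : a <= c + C -> b <= d + C -> Num.max a b <= Num.max c d + C.
  by move=> ac bd; rewrite ge_max -!lerBlDr !le_max !lerBlDr ac bd orbT.
have min_lip (a b c d C : R) : a <= c + C -> b <= d + C -> Num.min a b <= Num.min c d + C.
  by move=> ac bd; rewrite -lerBlDr le_min !lerBlDr !ge_min ac bd orbT.
have C0 (x y : R) : 0 <= e^-1 * `|x - y| by rewrite mulr_ge0// invr_ge0 ltW.
have one (x y : R) : trapezoid l r e x <= trapezoid l r e y + e^-1 * `|x - y|.
  apply: (max_lip); first by rewrite add0r.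
  apply: (min_lip); first by rewrite lerDl.
  have h1 : (x - y) / e <= e^-1 * `|x - y|.
    by rewrite [leLHS]mulrC ler_wpM2l ?invr_ge0 ?ler_norm// ltW.
  have h2 : (y - x) / e <= e^-1 * `|x - y|.
    by rewrite [leLHS]mulrC distrC ler_wpM2l ?invr_ge0 ?ler_norm// ltW.
  by apply: (min_lip); lra.
move=> x y; rewrite ler_norml; have := one x y; have := one y x; rewrite (distrC y x).
by move=> h1 h2; apply/andP; split; lra.
Qed.

Lemma trapezoid_bdm (l r e : R) : 0 < e -> bdm (trapezoid l r e).
Proof.
move=> e0; split.
  apply: continuous_measurable_fun.
  exact: lipschitz_continuous (trapezoid_lipschitz l r e0).
by exists 1 => x; rewrite ger0_norm ?trapezoid_ge0 ?trapezoid_le1.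
Qed.

Lemma trapezoid_supp (l r e : R) : 0 < e ->
  exists2 M, 0 <= M & forall x, M <= `|x| -> trapezoid l r e x = 0.
Proof.
move=> e0; exists (`|l| + `|r| + e); first by rewrite !addr_ge0// ltW.
move=> x; have := normr_ge0 l; have := normr_ge0 r.
have := ler_norm r; have := ler_norm (- l); rewrite normrN => h1 h2 h3 h4.
have [x0|x0] := leP 0 x => Mx.
  by rewrite (ger0_norm x0) in Mx; rewrite trapezoid0r//; lra.
by rewrite (ltr0_norm x0) in Mx; rewrite trapezoid0l//; lra.
Qed.

End trapezoid.

(** * From Stein's bound to the distribution function *)

Section normal_approximation.
Context {R : realType} {d : measure_display} {T : measurableType d}.
Variables (P : probability T R) (S : nat -> T -> R).
Hypothesis bS : forall n, bdm (S n).
Hypothesis S2 : forall n, Ex P (fun w => S n w ^+ 2) <= 1.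
Hypothesis SH : forall (f f' : R -> R) (B L e : R),
  measurable_fun setT f -> measurable_fun setT f' ->
  (exists M : R, forall x, `|f x| <= M) -> (forall x, `|f' x| <= B) ->
  0 <= L -> (forall s t, `|f s - f (s - t) - t * f' s| <= L * t ^+ 2) -> 0 < e ->
  \forall n \near \oo,
    `|Ex P (fun w => S n w * f (S n w) - f' (S n w))| <= (L + B) * (2 * e).

Let bcomp n (u : R -> R) : bdm u -> bdm (fun w => u (S n w)).
Proof. by move=> [mu bu]; apply: bdm_comp => //; case: (bS n). Qed.

Lemma stein_cvg0 (k : R -> R) (M Lk e : R) : 0 <= M ->
  (forall x y, `|k x - k y| <= Lk * `|x - y|) ->
  (forall x, M <= `|x| -> k x = 0) -> normal_Ex k = 0 -> 0 < e ->
  \forall n \near \oo, `|Ex P (fun w => k (S n w))| <= e.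
Proof.
move=> M0 kL kM k0 e0.
have [f [f' [B [L [mf mf' bf f'B [L0 fL fk]]]]]] := stein_solution M0 kL kM k0.
have B0 : 0 <= B by apply: le_trans (f'B 0).
(* The summand 1 keeps the divisor positive when [L] and [B] are both 0. *)
have LB : 0 < (L + B) * 2 + 1 by rewrite ltr_pwDr// mulr_ge0// addr_ge0.
have e1 : 0 < e / ((L + B) * 2 + 1) by rewrite divr_gt0.
apply: filterS (SH mf mf' bf f'B L0 fL e1) => n h.
have -> : `|Ex P (fun w => k (S n w))| =
    `|Ex P (fun w => S n w * f (S n w) - f' (S n w))|.
  have bk : bdm k.
    have [b _ kb] := continuous_compact_supp_bounded M0 (lipschitz_continuous kL) kM.
    split; last by exists b.
    exact: continuous_measurable_fun (lipschitz_continuous kL).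
  rewrite -normrN -ExN; last exact: bcomp.
  by congr `|_|; apply: eq_Ex => w; rewrite fk.
apply: (le_trans h); rewrite mulrA mulrA ler_pdivrMr// mulrC ler_wpM2l ?ltW//.
by rewrite ltrDl.
Qed.

Let chi K : R -> R := trapezoid (- K%:R) K%:R 1.

Let chi1 (K : nat) x : `|x| <= K%:R -> chi K x = 1.
Proof. by rewrite ler_norml => Kx; exact: trapezoid1. Qed.

(** Since K >= 1, s^2 >= |s| > K. The rate 1/K, weaker than Chebyshev's, is enough for tightness. *)
Let markov (K : nat) (s : R) : (0 < K)%N -> K%:R < `|s| -> 1 <= K%:R^-1 * s ^+ 2.
Proof.
move=> K0 h; have K1 : 1 <= K%:R :> R by rewrite ler1n.
rewrite ler_pdivlMl ?ltr0n// mulr1 -real_normK ?num_real// (le_trans (ltW h))//.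
by rewrite expr2 ler_peMr// (le_trans K1)// ltW.
Qed.

Let markov_Ex n (K : nat) : Ex P (fun w => K%:R^-1 * S n w ^+ 2) <= K%:R^-1.
Proof.
by have bSn := bS n; rewrite ExZ; [rewrite ler_piMr ?invr_ge0 ?ler0n|bdm].
Qed.

Let tail_S n (K : nat) : (0 < K)%N -> 1 - Ex P (fun w => chi K (S n w)) <= K%:R^-1.
Proof.
move=> K0; have bchi := bcomp n (trapezoid_bdm (- K%:R) K%:R ltr01); have bSn := bS n.
rewrite -[X in X - _](Ex_cst P) -ExB//; last exact: bdm_cst.
apply: le_trans (markov_Ex n K).
apply: Ex_le; [bdm|bdm|move=> w].
have [h|h] := leP `|S n w| K%:R.
  by rewrite chi1// subrr mulr_ge0 ?invr_ge0 ?sqr_ge0.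
by apply: le_trans (markov K0 h); rewrite gerBl trapezoid_ge0.
Qed.

Let tail_N (K : nat) : 1 - normal_Ex (chi K) <= fine (@normal_prob R 0 1 [set x | K%:R < `|x|]).
Proof.
have mA := @measurable_gt_norm R K%:R.
have bchi := trapezoid_bdm (- K%:R : R) K%:R ltr01.
have bA := @bdm_indic R _ _ _ mA.
rewrite -normal_Ex_indic// -[X in X - _]normal_Ex1 lerBlDr -normal_ExD//.
apply: normal_Ex_le; [exact: bdm_cst|exact: bdmD|move=> x].
rewrite indicE; have [h|h] := leP `|x| K%:R.
  by rewrite chi1// lerDr.
by rewrite mem_set// lerDl trapezoid_ge0.
Qed.

Lemma test_function_cvg (l r e : R) : 0 < e ->
  Ex P (fun w => trapezoid l r e (S n w)) @[n --> \oo] --> normal_Ex (trapezoid l r e).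
Proof.
move=> e0; set u := trapezoid l r e; set b := normal_Ex u.
have bu : bdm u by exact: trapezoid_bdm.
have b01 : 0 <= b <= 1.
  apply/andP; split.
    by apply: Rintegral_ge0 => x _; rewrite mulr_ge0 ?trapezoid_ge0 ?normal_pdf_ge0.
  rewrite -[leRHS]normal_Ex1; apply: normal_Ex_le => //; first exact: bdm_cst.
  exact: trapezoid_le1.
apply/cvgrPdist_le => t t0; have t3 : 0 < t / 3 by rewrite divr_gt0.
have [K [K0 KN KS]] : exists K : nat, [/\ (0 < K)%N,
    fine (@normal_prob R 0 1 [set x | K%:R < `|x|]) <= t / 3 & K%:R^-1 <= t / 3].
  have [K _ hK] := normal_tail t3.
  pose K' := maxn K (Num.truncn (t / 3)^-1).+1; exists K'.
  have K'0 : (0 < K')%N by rewrite /K' leq_max orbT.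
  split => //; first by apply: hK; rewrite /= /K' leq_maxl.
  rewrite invf_ple ?posrE ?ltr0n//; apply: (@le_trans _ _ (Num.truncn (t / 3)^-1).+1%:R).
    by rewrite ltW// truncnS_gt.
  by rewrite ler_nat /K' leq_maxr.
set c := normal_Ex (chi K).
have bchi : bdm (chi K) by exact: trapezoid_bdm.
have c1 : c <= 1.
  rewrite -[leRHS]normal_Ex1.
  by apply: normal_Ex_le => // [|x]; [exact: bdm_cst|exact: trapezoid_le1].
(* The coefficients are each other's Gaussian means, so the mean of [k] is c b - b c = 0. *)
pose k x := c * u x + (- b) * chi K x.
have [M1 M10 uM] := trapezoid_supp l r e0.
have [M2 M20 chiM] := trapezoid_supp (- K%:R : R) K%:R ltr01.
have k0 : normal_Ex k = 0.
  rewrite normal_ExD; [|exact: bdmM (bdm_cst _) _|exact: bdmM (bdm_cst _) _].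
  by rewrite !normal_ExZ// -/b -/c; ring.
have M0 : 0 <= Num.max M1 M2 by rewrite le_max M10.
have kL x y : `|k x - k y| <= (`|c| * e^-1 + `|b| * 1^-1) * `|x - y|.
  have -> : k x - k y = c * (u x - u y) + (- b) * (chi K x - chi K y).
    by rewrite /k; ring.
  rewrite (le_trans (ler_normD _ _))// mulrDl !normrM normrN -!mulrA.
  by apply: lerD; apply: ler_wpM2l => //; exact: trapezoid_lipschitz.
have kM x : Num.max M1 M2 <= `|x| -> k x = 0.
  rewrite ge_max => /andP[h1 h2].
  by rewrite /k /u uM// /chi chiM// !mulr0 addr0.
apply: filterS (stein_cvg0 M0 kL kM k0 t3) => n.
have bun := bcomp n bu; have bcn := bcomp n bchi.
rewrite /k ExD; [|bdm|bdm]; rewrite !ExZ//.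
have := tail_S n K0; have := tail_N K; rewrite -/c.
set s := Ex P (fun w => u (S n w)); set q := Ex P (fun w => chi K (S n w)).
have s01 : 0 <= s <= 1.
  apply/andP; split; first by apply: Ex_ge0 => w; exact: trapezoid_ge0.
  rewrite -[leRHS](Ex_cst P); apply: Ex_le => //; first exact: bdm_cst.
  by move=> w; exact: trapezoid_le1.
have q1 : q <= 1.
  rewrite -[leRHS](Ex_cst P); apply: Ex_le => //; first exact: bdm_cst.
  by move=> w; exact: trapezoid_le1.
move=> hc hq; rewrite !ler_norml => /andP[h1 h2].
case/andP: b01 => b0 b1; case/andP: s01 => s0 s1.
(* The three errors come from s - b = (c s - b q) + (1 - c) s - (1 - q) b. *)
have x1 : 0 <= (1 - c) * s by rewrite mulr_ge0// subr_ge0.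
have x2 : (1 - c) * s <= t / 3.
  by rewrite (le_trans (ler_piMr _ s1)) ?subr_ge0// (le_trans hc).
have x3 : 0 <= (1 - q) * b by rewrite mulr_ge0// subr_ge0.
have x4 : (1 - q) * b <= t / 3.
  by rewrite (le_trans (ler_piMr _ b1)) ?subr_ge0// (le_trans hq).
by apply/andP; split; nra.
Qed.

Let mSx n x : measurable [set w | S n w <= x].
Proof.
rewrite (_ : [set _ | _] = S n @^-1` `]-oo, x]%classic).
  rewrite -[X in measurable X]setTI; case: (bS n) => mS _; exact: mS.
by apply/seteqP; split => w /=; rewrite in_itv.
Qed.

Lemma Ex_indic (A : set T) : measurable A -> Ex P \1_A = fine (P A).
Proof. by move=> mA; rewrite /Ex /Rintegral integral_indic// setIT. Qed.

(** The indicator of [S n w <= x] lies above the trapezoid ending at x - e + e = x, and below the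
    one with plateau up to x plus a Markov term for values under -K. Each side loses three quarters
    of [t]: a tail or the Lipschitz cost of moving by [e] in the Gaussian law, the Markov bound, and
    the convergence of the test function. *)
Lemma normal_approximation x :
  fine (P [set w | S n w <= x]) @[n --> \oo] --> normal_cdf x.
Proof.
apply/cvgrPdist_le => t t0; have t4 : 0 < t / 4 by rewrite divr_gt0.
have pk : 0 < normal_peak 1 :> R by rewrite normal_peak_gt0// oner_neq0.
pose e := t / 4 / normal_peak 1; have e0 : 0 < e by rewrite divr_gt0.
have [K0 _ hK] := normal_tail t4.
pose K := maxn K0 (Num.truncn (t / 4)^-1).+1.
have Kp : (0 < K)%N by rewrite /K leq_max orbT.
have KN := hK K (leq_maxl _ _).
have KS : K%:R^-1 <= t / 4.
  rewrite invf_ple ?posrE ?ltr0n//; apply: (@le_trans _ _ (Num.truncn (t / 4)^-1).+1%:R).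
    by rewrite ltW// truncnS_gt.
  by rewrite ler_nat /K leq_maxr.
have /cvgrPdist_le/(_ _ t4) up := @test_function_cvg (- K%:R) x e e0.
have /cvgrPdist_le/(_ _ t4) lo := @test_function_cvg (- K%:R) (x - e) e e0.
have cdfE y : normal_cdf y = normal_Ex \1_(`]-oo, y]%classic : set R).
  by rewrite normal_Ex_indic.
have bI y : bdm (\1_(`]-oo, y]%classic) : R -> R) by exact: bdm_indic.
have Nup : normal_Ex (trapezoid (- K%:R) x e) <= normal_cdf (x + e).
  rewrite cdfE; apply: normal_Ex_le => //; first exact: trapezoid_bdm.
  move=> y; rewrite indicE; have [h|h] := leP y (x + e).
    by rewrite mem_set ?trapezoid_le1//= in_itv.
  by rewrite trapezoid0r// ltW.
have mA := @measurable_gt_norm R K%:R.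
have Nlo : normal_cdf (x - e) <= normal_Ex (trapezoid (- K%:R) (x - e) e) + t / 4.
  apply: le_trans (_ : normal_Ex (trapezoid (- K%:R) (x - e) e) +
      normal_Ex \1_[set x : R | K%:R < `|x|] <= _); last first.
    by rewrite lerD2l normal_Ex_indic.
  have bA := @bdm_indic R _ _ _ mA; have btr := trapezoid_bdm (- K%:R) (x - e) e0.
  rewrite cdfE -normal_ExD//; apply: normal_Ex_le => //; first exact: bdmD.
  move=> y; rewrite [leLHS]indicE; have [h|h] := leP y (x - e); last first.
    rewrite memNset; first by rewrite addr_ge0 ?trapezoid_ge0// indicE.
    by rewrite /= in_itv/= => /le_lt_trans/(_ h); rewrite ltxx.
  rewrite mem_set; last by rewrite /= in_itv.
  have [Ky|Ky] := leP (- K%:R) y; first by rewrite trapezoid1 ?Ky// lerDl indicE.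
  rewrite indicE mem_set; first by rewrite lerDr trapezoid_ge0.
  rewrite /= ltrNr in Ky *; apply: (lt_le_trans Ky).
  by rewrite -normrN ler_norm.
have Fe y z : `|y - z| = e -> `|normal_cdf y - normal_cdf z| <= t / 4.
  move=> yz; apply: (le_trans (normal_cdf_lipschitz y z)).
  by rewrite yz /e mulrC divfK// gt_eqF.
have F1 : `|normal_cdf (x + e) - normal_cdf x| <= t / 4.
  by apply: Fe; rewrite addrAC subrr add0r gtr0_norm.
have F2 : `|normal_cdf x - normal_cdf (x - e)| <= t / 4.
  by apply: Fe; rewrite opprB addrC subrK gtr0_norm.
near=> n.
have Sup : fine (P [set w | S n w <= x]) <=
    Ex P (fun w => trapezoid (- K%:R) x e (S n w)) + t / 4.
  have btr := bcomp n (trapezoid_bdm (- K%:R) x e0).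
  have bSn := bS n.
  have bI' : bdm (\1_[set w | S n w <= x] : T -> R) by exact: bdm_indic.
  apply: le_trans (_ : Ex P (fun w => trapezoid (- K%:R) x e (S n w)) +
      Ex P (fun w => K%:R^-1 * S n w ^+ 2) <= _); last first.
    by rewrite lerD2l (le_trans (markov_Ex n K)).
  rewrite -ExD//; last by bdm.
  rewrite -Ex_indic//; apply: Ex_le => //; first by bdm.
  move=> w; have s0 : 0 <= K%:R^-1 * S n w ^+ 2 by rewrite mulr_ge0 ?invr_ge0 ?sqr_ge0.
  rewrite indicE; have [h|h] := leP (S n w) x; last first.
    rewrite memNset; first by rewrite addr_ge0 ?trapezoid_ge0.
    by move=> /le_lt_trans/(_ h); rewrite ltxx.
  rewrite mem_set//.
  have [Ky|Ky] := leP (- K%:R) (S n w); first by rewrite trapezoid1 ?Ky// lerDl.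
  apply: (@le_trans _ _ (K%:R^-1 * S n w ^+ 2)); last by rewrite lerDr trapezoid_ge0.
  by apply: markov => //; rewrite ltrNr in Ky; rewrite (lt_le_trans Ky)// -normrN ler_norm.
have Slo : Ex P (fun w => trapezoid (- K%:R) (x - e) e (S n w)) <=
    fine (P [set w | S n w <= x]).
  have btr := bcomp n (trapezoid_bdm (- K%:R) (x - e) e0).
  rewrite -Ex_indic//; apply: Ex_le => //; first exact: bdm_indic.
  move=> w; rewrite indicE; have [h|h] := leP (S n w) x.
    by rewrite mem_set ?trapezoid_le1.
  by rewrite trapezoid0r// subrK ltW.
have : `|normal_Ex (trapezoid (- K%:R) x e) -
    Ex P (fun w => trapezoid (- K%:R) x e (S n w))| <= t / 4.
  by near: n.
have : `|normal_Ex (trapezoid (- K%:R) (x - e) e) -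
    Ex P (fun w => trapezoid (- K%:R) (x - e) e (S n w))| <= t / 4.
  by near: n.
move: F1 F2; rewrite !ler_norml => /andP[? ?] /andP[? ?] /andP[? ?] /andP[? ?].
by apply/andP; split; lra.
Unshelve. all: by end_near.
Qed.

End normal_approximation.

(** * The two forms of the statistic, and the limit *)

Lemma sum_offdiag (R : realType) (n : nat) (h : 'I_n -> 'I_n -> R) :
  (forall i j, h i j = h j i) ->
  \sum_(i < n) \sum_(j < n | j != i) h i j =
  2 * \sum_(i < n) \sum_(j < n | (i < j)%N) h i j.
Proof.
move=> hC.
have -> : \sum_(i < n) \sum_(j < n | j != i) h i j =
    \sum_(i < n) \sum_(j < n | (i < j)%N) h i j +
    \sum_(i < n) \sum_(j < n | (j < i)%N) h i j.
  rewrite -big_split; apply: eq_bigr => i _.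
  rewrite (bigID (fun j : 'I_n => (i < j)%N))/=; congr (_ + _); apply: eq_bigl => j.
    by case: ltngtP => // ij; rewrite ?andbF// andbT; apply/eqP => ji; rewrite ji ltnn in ij.
  rewrite -leqNgt leq_eqVlt -(inj_eq val_inj)/=.
  by case: (ltngtP j i).
rewrite [X in _ + X](exchange_big_dep predT)//= mulr2n mulrDl mul1r; congr (_ + _).
by apply: eq_bigr => i _; apply: eq_bigr => j _.
Qed.

Section statistic.
Context {R : realType} {d : measure_display} {T : measurableType d}.
Variables (P : probability T R) (n p q : nat).
Variables (X : 'I_n -> T -> 'rV[R]_p) (Y : 'I_n -> T -> 'rV[R]_q).
Hypotheses (p0 : (0 < p)%N) (q0 : (0 < q)%N).
Hypothesis iidXY : iid P (fun (i : 'I_n) w => row_mx (X i w) (Y i w)).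
Hypothesis rvXY : forall i, random_vector (X i) /\ random_vector (Y i).
Hypothesis indXY : forall i, indep2 P (X i) (Y i).
Hypothesis sphXY : forall i, spherical_directions P (X i) /\ spherical_directions P (Y i).
Local Notation g := (dir_kernel X Y).
Local Notation D := ((p * q)%:R : R).

Let D0 : 0 < D. Proof. by rewrite ltr0n muln_gt0 p0. Qed.

Lemma half_sum_I_St_alt : half_sum D g = I_St_alt X Y.
Proof.
apply/funext => w; rewrite /half_sum /leave_out sum_offdiag; last first.
  by move=> i j; rewrite /scaled_kernel dir_kernelC.
rewrite mulKf ?pnatr_eq0// /I_St_alt mulr_sumr; apply: eq_bigr => i _.
by rewrite mulr_sumr.
Qed.

Lemma I_St_alt_bdm : bdm (I_St_alt X Y).
Proof.
by rewrite -half_sum_I_St_alt; apply: half_sum_bdm; exact: (dir_kernel_bdm iidXY).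
Qed.

Lemma I_St_bdm : bdm (I_St X Y).
Proof.
rewrite /I_St /I_stat; apply: bdmM; last exact: bdm_cst.
apply: bdmD; last exact: bdm_cst.
apply: bdmM; first exact: bdm_cst.
by apply: bdm_sum => i _; apply: bdm_sum => j _; exact: (dir_kernel_bdm iidXY).
Qed.

(** The diagonal of the double sum equals n only where all directions are unit vectors, hence almost
    surely. For n = 0 division by 0 gives 0 and the two forms differ. *)
Lemma I_St_ae : (0 < n)%N -> \forall w \ae P, I_St X Y w = I_St_alt X Y w.
Proof.
move=> n0.
have ae1 : \forall w \ae P, forall i, g i i w = 1.
  apply: filter_forall => i; have [[_ sX] [_ sY]] := sphXY i.
  have aeU := uniform_ae (bdm_U iidXY i) sX; have aeV := uniform_ae (bdm_V iidXY i) sY.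
  by apply: filterS2 aeU aeV => w u v; rewrite /dir_kernel u v mulr1.
apply: filterS ae1 => w gii.
rewrite /I_St /I_stat /I_St_alt -/(\sum_(i < n) \sum_(j < n | (i < j)%N) g i j w).
set s := \sum_(i < n) \sum_(j < n | (i < j)%N) g i j w.
have -> : \sum_(i < n) \sum_(j < n) (dotv (direction (X i w)) (direction (X j w)) *
    dotv (direction (Y i w)) (direction (Y j w))) = n%:R + 2 * s.
  rewrite /s -(sum_offdiag (h := fun i j => g i j w)); last first.
    by move=> i j; exact: dir_kernelC.
  rewrite -[n%:R](_ : \sum_(i < n) 1 = _); last by rewrite sumr_const card_ord.
  rewrite -big_split/=; apply: eq_bigr => i _.
  by rewrite (bigD1 i)//= -(gii i).
have r0 : Num.sqrt (2 * D) != 0 by rewrite gt_eqF// sqrtr_gt0 mulr_gt0.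
have r2 : D = Num.sqrt (2 * D) ^+ 2 / 2.
  by rewrite sqr_sqrtr ?mulr_ge0// mulrC mulKf// pnatr_eq0.
(* Writing D as r^2 / 2 leaves a rational identity in r. *)
rewrite {1 2}r2; move: (Num.sqrt (2 * D)) r0 => r r0.
by field; rewrite r0 pnatr_eq0 -lt0n n0.
Qed.

Lemma I_St_moment2 : (0 < n)%N -> Ex P (fun w => I_St_alt X Y w ^+ 2) <= 1.
Proof.
move=> n0; rewrite -half_sum_I_St_alt.
apply: (half_sum_moment2 (F := others (fun i w => row_mx (X i w) (Y i w)))) => //.
- by move=> i G; apply: free_bdm; case: iidXY.
- by move=> i j w; exact: dir_kernelC.
- exact: (dir_kernel_bdm iidXY).
- by move=> k i j; exact: dir_kernel_free.
- by move=> i j G; exact: (dir_kernel_moment1 iidXY rvXY indXY sphXY).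
- by move=> i j k G; exact: (dir_kernel_moment2 p0 q0 iidXY rvXY indXY sphXY).
- by move=> i G; exact: (dir_kernel_diag iidXY sphXY).
Qed.

Lemma I_St_stein (f f' : R -> R) (B L e : R) : (0 < n)%N ->
  measurable_fun setT f -> measurable_fun setT f' ->
  (exists M : R, forall x, `|f x| <= M) -> (forall x, `|f' x| <= B) ->
  0 <= L -> (forall s t, `|f s - f (s - t) - t * f' s| <= L * t ^+ 2) -> 0 < e ->
  `|Ex P (fun w => I_St_alt X Y w * f (I_St_alt X Y w) - f' (I_St_alt X Y w))| <=
  L * (e + 12 / n%:R / e) + B * (e + (2 / D + 23 / n%:R) / e).
Proof.
move=> n0; rewrite -half_sum_I_St_alt.
apply: (half_sum_stein (F := others (fun i w => row_mx (X i w) (Y i w)))) => //.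
- by move=> i G; apply: free_bdm; case: iidXY.
- by move=> i j w; exact: dir_kernelC.
- exact: (dir_kernel_bdm iidXY).
- by move=> k i j; exact: dir_kernel_free.
- by move=> i j G; exact: (dir_kernel_moment1 iidXY rvXY indXY sphXY).
- by move=> i j k G; exact: (dir_kernel_moment2 p0 q0 iidXY rvXY indXY sphXY).
- by move=> i j k l G; exact: (dir_kernel_moment3 iidXY rvXY indXY sphXY).
- by move=> i j; exact: (dir_kernel_moment4 p0 q0 iidXY rvXY indXY sphXY).
- by move=> i G; exact: (dir_kernel_diag iidXY sphXY).
Qed.

End statistic.

Lemma ae_eq_neq0 (R : realType) (d : measure_display) (T : measurableType d)
    (P : probability T R) (f g : T -> R) : bdm f -> bdm g ->
  (\forall w \ae P, f w = g w) -> P [set w | f w <> g w] = 0%E.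
Proof.
move=> bf bg fg; apply: measure_negligible; last exact: fg.
have [m _] := bdmD bf (bdmN bg).
rewrite (_ : [set _ | _] = (fun w => f w - g w) @^-1` (~` [set 0])).
  by rewrite -[X in measurable X]setTI; apply: m => //; exact: measurableC.
apply/seteqP; split => w /=; first by move=> h /eqP; rewrite subr_eq0 => /eqP.
by move=> h fgw; apply: h; rewrite fgw subrr.
Qed.

Theorem theorem5 (R : realType) (d : measure_display) (Omega : measurableType d)
  (P : probability Omega R) (p q : nat -> nat)
  (X : forall n : nat, 'I_n -> Omega -> 'rV[R]_(p n))
  (Y : forall n : nat, 'I_n -> Omega -> 'rV[R]_(q n)) :
  (forall n, (0 < p n)%N) -> (forall n, (0 < q n)%N) ->
  (forall M : nat, exists N : nat, forall n, (N <= n)%N -> (M <= maxn (p n) (q n))%N) ->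
  (forall n, iid P (fun i : 'I_n => fun w => row_mx (X n i w) (Y n i w))) ->
  (forall n (i : 'I_n), random_vector (X n i) /\ random_vector (Y n i)) ->
  (forall n (i : 'I_n), indep2 P (X n i) (Y n i)) ->
  (forall n (i : 'I_n), spherical_directions P (X n i) /\ spherical_directions P (Y n i)) ->
  (forall n, (0 < n)%N ->
     P [set w | I_St (X n) (Y n) w <> I_St_alt (X n) (Y n) w] = 0%E) /\
  (forall x : R,
     (fun n => P [set w | I_St (X n) (Y n) w <= x]) @ \oo
       --> normal_prob 0 1 `]-oo, x]).
Proof.
move=> p0 q0 pq iidXY rvXY indXY sphXY.
have bI n : bdm (I_St (X n) (Y n)) := I_St_bdm (iidXY n).
have bS n : bdm (I_St_alt (X n) (Y n)) := I_St_alt_bdm (iidXY n).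
have ae n : (0 < n)%N -> \forall w \ae P, I_St (X n) (Y n) w = I_St_alt (X n) (Y n) w.
  exact: (I_St_ae (p0 n) (q0 n) (iidXY n) (sphXY n)).
split => [n n0|x]; first by apply: ae_eq_neq0 => //; exact: ae.
have S2 n : Ex P (fun w => I_St_alt (X n) (Y n) w ^+ 2) <= 1.
  have [n0|n0] := posnP n; last first.
    exact: (I_St_moment2 (p0 n) (q0 n) (iidXY n) (rvXY n) (indXY n) (sphXY n)).
  (* For n = 0 the statistic is an empty sum, so the moment bound holds for every index. *)
  rewrite -[leRHS](Ex_cst P); apply: Ex_le; [exact: bdmX|exact: bdm_cst|move=> w].
  rewrite /I_St_alt [X in _ * X]big1; first by rewrite mulr0 expr0n ler01.
  by move=> [i ni]; exfalso; rewrite n0 in ni.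
(* Both dimensions being positive, their product is at least their maximum. *)
have big (M : R) : \forall n \near \oo, M <= n%:R /\ M <= (p n * q n)%:R.
  pose K := (Num.truncn M).+1; have MK : M <= K%:R by rewrite ltW// truncnS_gt.
  have [N hN] := pq K; exists (maxn N K) => // n /=; rewrite geq_max => /andP[Nn Kn].
  split; rewrite (le_trans MK)// ler_nat// (leq_trans (hN n Nn))// geq_max.
  by rewrite leq_pmulr ?leq_pmull.
have SH (f f' : R -> R) (B L e : R) :
    measurable_fun setT f -> measurable_fun setT f' ->
    (exists M : R, forall x, `|f x| <= M) -> (forall x, `|f' x| <= B) ->
    0 <= L -> (forall s t, `|f s - f (s - t) - t * f' s| <= L * t ^+ 2) -> 0 < e ->
    \forall n \near \oo, `|Ex P (fun w => I_St_alt (X n) (Y n) w *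
      f (I_St_alt (X n) (Y n) w) - f' (I_St_alt (X n) (Y n) w))| <= (L + B) * (2 * e).
  move=> mf mf' bf f'B L0 fL e0; have B0 : 0 <= B by apply: le_trans (f'B 0).
  have e2 : 0 < e ^+ 2 by rewrite exprn_gt0.
  (* Here 25 = 2 + 23: once 1/n and 1/(pq) are below e^2 / 25, both quotients by [e] in the Stein
     bound are at most [e]. *)
  apply: filterS2 (big 1) (big (25 / e ^+ 2)) => n [n1 _] [nb Db].
  have n0 : 0 < n%:R :> R by exact: lt_le_trans n1.
  have n0' : (0 < n)%N by rewrite -(ltr0n R).
  have D0 : 0 < (p n * q n)%:R :> R by rewrite ltr0n muln_gt0 p0 q0.
  apply: (le_trans (I_St_stein (p0 n) (q0 n) (iidXY n) (rvXY n) (indXY n) (sphXY n)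
    n0' mf mf' bf f'B L0 fL e0)).
  have nI : n%:R^-1 <= e ^+ 2 / 25 by rewrite invf_ple ?posrE ?invf_div// divr_gt0.
  have DI : (p n * q n)%:R^-1 <= e ^+ 2 / 25 by rewrite invf_ple ?posrE ?invf_div// divr_gt0.
  have ee : e ^+ 2 / e = e by rewrite expr2 mulfK// gt_eqF.
  have h1 : 12 / n%:R / e <= e by rewrite -[leRHS]ee ler_pM2r ?invr_gt0//; lra.
  have h2 : (2 / (p n * q n)%:R + 23 / n%:R) / e <= e.
    by rewrite -[leRHS]ee ler_pM2r ?invr_gt0//; lra.
  by rewrite (mulrDl L B); apply: lerD; apply: ler_wpM2l => //; lra.
have cv := normal_approximation bS S2 SH (x := x).
have mI (Z : Omega -> R) : bdm Z -> measurable [set w | Z w <= x].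
  move=> [mZ _]; rewrite (_ : [set _ | _] = Z @^-1` `]-oo, x]%classic).
    by rewrite -[X in measurable X]setTI; exact: mZ.
  by apply/seteqP; split => w /=; rewrite in_itv.
(* The limit is proved for [I_St_alt] and carried over to [I_St] by almost sure equality; the index
   0 does not affect the limit. *)
have PE n : (0 < n)%N -> fine (P [set w | I_St_alt (X n) (Y n) w <= x]) =
    fine (P [set w | I_St (X n) (Y n) w <= x]).
  move=> n0; rewrite -!Ex_indic; [|exact: mI..].
  apply: Ex_ae; [by apply: bdm_indic; exact: mI..|].
  apply: filterS (ae n n0) => w e; rewrite !indicE.
  by congr (_%:R); congr nat_of_bool; apply/idP/idP; rewrite !inE/= e.
have -> : normal_prob 0 1 `]-oo, x] = (normal_cdf x)%:E.
  by rewrite /normal_cdf fineK//; exact: fin_num_measure.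
apply/fine_cvgP; split.
  by apply: nearW => n; apply: fin_num_measure; exact: mI.
apply: cvg_trans cv; apply: near_eq_cvg; exists 1%N => // n /= n0.
Qed.
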